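(* Let $\mathsf R$ be a multivariate Ore extension of a domain $R$, let $F=\{g_1,\dots,g_u\}\subset\mathsf R^m\setminus\{0\}$ be a finite set, let $\mathsf M:=\mathbb I_2(F)\subset\mathsf R^m$ be the bilateral module it generates, and let $\mathfrak{GM}(F)$ be any bilateral Gebauer–Möller set for $F$. Then the following conditions are equivalent: (1) $F$ is a bilateral Gröbner basis of $\mathsf M$; (2) for $f\in\mathsf R^m\setminus\{0\}$: $f\in\mathsf M$ if and only if $f$ has a bilateral (weak) Gröbner representation in terms of $F$; (3) for each $\sigma\in\mathfrak{GM}(F)$, the bilateral S-polynomial $\mathfrak S_2(\sigma)$ has a bilateral quasi-Gröbner representation $\mathfrak S_2(\sigma)=\sum_{l=1}^\mu a_l\lambda_l\star g_{\ell_l}\star b_l\rho_l$ in terms of $F$; (4) each $\sigma\in\mathfrak{GM}(F)$ has a lifting; (5) each nonzero $\mathcal T^{(m)}$-homogeneous element of $\ker(\mathfrak s_2)$ has a lifting.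
   Context: **Ore extensions.** $R$ is a (not necessarily commutative) domain with identity. A multivariate Ore extension $\mathsf R=R[Y_1;\alpha_1,\delta_1]\cdots[Y_n;\alpha_n,\delta_n]$ is an iterated Ore extension ($Y_i\star r=\alpha_i(r)Y_i+\delta_i(r)$, $\alpha_i$ an injective ring endomorphism mapping $R$ to $R$, $\delta_i$ an $\alpha_i$-derivation mapping $R$ to $R$, i.e. additive with $\delta_i(rr')=\alpha_i(r)\delta_i(r')+\delta_i(r)r'$) such that $\alpha_j\delta_i=\delta_i\alpha_j$ for $i\ne j$, $\alpha_i\alpha_j=\alpha_j\alpha_i$, $\delta_i\delta_j=\delta_j\delta_i$, and $\alpha_j(Y_i)=Y_i$, $\delta_j(Y_i)=0$ for $i<j$. Its multiplication is $\star$. It is a free left $R$-module on the set of terms $\mathcal T=\{Y_1^{a_1}\cdots Y_n^{a_n}\}$, a commutative monoid whose product is written $\circ$. For $\tau=Y_1^{a_1}\cdots Y_n^{a_n}$ put $\alpha_\tau=\alpha_1^{a_1}\cdots\alpha_n^{a_n}:R\to R$. The associated graded Ore extension $\mathsf S=R[Y_1;\alpha_1]\cdots[Y_n;\alpha_n]$ is the same left $R$-module with multiplication $\ast$ determined by $(a\tau)\ast(b\omega)=a\,\alpha_\tau(b)\,\tau\circ\omega$. **Orderings.** $\mathsf R^m$ has canonical basis $\mathbf e_1,\dots,\mathbf e_m$ (with $r\star(s\mathbf e_i)\star t=(r\star s\star t)\mathbf e_i$) and terms $\mathcal T^{(m)}=\{t\mathbf e_i\}$. Fix a term ordering $\prec$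 on $\mathcal T$ and a compatible term ordering $<$ on $\mathcal T^{(m)}$: a well-ordering with $\omega_1\prec\omega_2\Rightarrow\omega_1t<\omega_2t$ and $t_1<t_2\Rightarrow\omega t_1<\omega t_2$. For $f\ne0$, $\mathbf T(f)$ is its maximal term, $\mathrm{lc}(f)\in R$ the coefficient of $\mathbf T(f)$, and $\mathbf M(f)=\mathrm{lc}(f)\mathbf T(f)$. **Gröbner notions (bilateral).** $F$ is a bilateral (weak) Gröbner basis of $\mathsf M=\mathbb I_2(F)$ if for every $f\in\mathsf M\setminus\{0\}$, $\mathbf M(f)=\sum_ia_i\lambda_i\ast\mathbf M(g_{\ell_i})\ast b_i\rho_i$ (finite sum) with $a_i,b_i\in R\setminus\{0\}$, $\lambda_i,\rho_i\in\mathcal T$, $\lambda_i\circ\mathbf T(g_{\ell_i})\circ\rho_i=\mathbf T(f)$. A bilateral (weak) Gröbner representation of $f\ne0$ is $f=\sum_ia_i\lambda_i\star g_{\ell_i}\star b_i\rho_i$ with $a_i,b_i\in R\setminus\{0\}$, $\lambda_i,\rho_i\in\mathcal T$ and $\lambda_i\circ\mathbf T(g_{\ell_i})\circ\rho_i\le\mathbf T(f)$ for all $i$. **Syzygies.** Let $\hat R=\{a\in R: a\star h=h\star a\ \forall h\in\mathsf R\}$ (contained also in the center of $\mathsf S$). The bimodules $(\mathsf R\otimes_{\hat R}\mathsf R^{\mathrm{op}})^u$ (over $\mathsf R$) and $(\mathsf S\otimes_{\hat R}\mathsf S^{\mathrm{op}})^u$ (over $\mathsf S$) coincide as sets, have canonical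 basis $e_1,\dots,e_u$, and their elements are written $\sigma=\sum_ia_i\lambda_ie_{\ell_i}b_i\rho_i$ with $a_i,b_i\in R\setminus\{0\}$, $\lambda_i,\rho_i\in\mathcal T$. As an additive group each is the direct sum, over $(\lambda,\ell,\rho)\in\mathcal T\times\{1,\dots,u\}\times\mathcal T$, of the components spanned by the $a\lambda e_\ell b\rho$ ($a,b\in R$), each a copy of $R\otimes_{\hat R}R$; the $(\lambda,\ell,\rho)$-component is given degree $\lambda\circ\mathbf T(g_\ell)\circ\rho\in\mathcal T^{(m)}$. For $\sigma\neq0$, $v(\sigma)$ is the $<$-largest degree of a nonzero component, and the leading form $\mathcal L_2(\sigma)\in(\mathsf S\otimes_{\hat R}\mathsf S^{\mathrm{op}})^u$ is the sum of the components of degree $v(\sigma)$; $\sigma$ is $\mathcal T^{(m)}$-homogeneous if $\sigma=\mathcal L_2(\sigma)$. Define $\mathfrak s_2:(\mathsf S\otimes_{\hat R}\mathsf S^{\mathrm{op}})^u\to\mathsf S^m$, $\sum a_i\lambda_ie_{\ell_i}b_i\rho_i\mapsto\sum a_i\lambda_i\ast\mathbf M(g_{\ell_i})\ast b_i\rho_i$, and $\mathfrak S_2:(\mathsf R\otimes_{\hat R}\mathsf R^{\mathrm{op}})^u\to\mathsf R^m$, $\sum a_i\lambda_ie_{\ell_i}b_i\rho_i\mapsto\sum a_i\lambda_i\star g_{\ell_i}\star b_i\rho_i$. A bilateral Gebauer–Möller set for $F$ is a set of (nonzero) $\mathcal T^{(m)}$-homogeneous generators of the $\mathsf S$-bimodule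 $\ker(\mathfrak s_2)$. A homogeneous $\sigma\in\ker(\mathfrak s_2)$ has a lifting if there is $U\in\ker(\mathfrak S_2)$ with $\mathcal L_2(U)=\sigma$. $\mathfrak S_2(\sigma)$ has a bilateral quasi-Gröbner representation if $\mathfrak S_2(\sigma)=\sum_ia_i\lambda_i\star g_{\ell_i}\star b_i\rho_i$ with $a_i,b_i\in R\setminus\{0\}$, $\lambda_i,\rho_i\in\mathcal T$ and $\lambda_i\circ\mathbf T(g_{\ell_i})\circ\rho_i<v(\sigma)$ for all $i$. *)

(* Defs.v *)
From HB Require Import structures.
From mathcomp Require Import all_boot all_order all_algebra.
From mathcomp Require Import finmap.
From mathcomp Require Import monalg.
From mathcomp Require Import boolp classical_sets functions cardinality fsbigop.

Set Implicit Arguments.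
Unset Strict Implicit.
Unset Printing Implicit Defensive.

Import GRing.Theory.
Local Open Scope classical_set_scope.
Local Open Scope ring_scope.

(* Y_1^{a_1} ... Y_n^{a_n} is encoded by its exponent vector, so the product of
   terms is the addition + of exponent vectors and the term 1 is 0. *)
Definition term (n : nat) : Type := {ffun 'I_n -> nat}.

(* The mixins are opaque because unfolding them makes unification in
   {malg R[term n]} intractable. *)
Fact term_hasDecEq n : hasDecEq (term n).
Proof. exact: (hasDecEq.Build _ (@eqP {ffun 'I_n -> nat})). Qed.
HB.instance Definition _ n := term_hasDecEq n.
Fact term_hasChoice n : hasChoice (term n).
Proof. exact: (Choice.on {ffun 'I_n -> nat}). Qed.
HB.instance Definition _ n := term_hasChoice n.

Lemma eq_term n (t1 t2 : term n) : (forall i, t1 i = t2 i) -> t1 = t2.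
Proof. by move=> E; apply/ffunP. Qed.

Section TermMonoid.
Variable n : nat.
Implicit Types t : term n.

Definition term_add t1 t2 : term n := [ffun i => (t1 i + t2 i)%N].
Definition term_zero : term n := [ffun=> 0%N].

Lemma term_addA : associative term_add.
Proof. by move=> x y z; apply/ffunP => i; rewrite !ffunE addnA. Qed.
Lemma term_addC : commutative term_add.
Proof. by move=> x y; apply/ffunP => i; rewrite !ffunE addnC. Qed.
Lemma term_add0 : left_id term_zero term_add.
Proof. by move=> x; apply/ffunP => i; rewrite !ffunE. Qed.

End TermMonoid.

HB.instance Definition _ n :=
  GRing.isNmodule.Build (term n) (@term_addA n) (@term_addC n) (@term_add0 n).

Lemma termDE n (t1 t2 : term n) i : (t1 + t2) i = (t1 i + t2 i)%N.
Proof. by rewrite ffunE. Qed.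

Lemma term0E n i : (0 : term n) i = 0%N.
Proof. by rewrite ffunE. Qed.

(* (t, i) stands for t e_i *)
Notation mterm n m := (term n * 'I_m)%type.

Definition mtmul n m (w : term n) (t : mterm n m) : mterm n m := (w + t.1, t.2).

Definition well_order (T : eqType) (lt : rel T) : Prop :=
  [/\ irreflexive lt, transitive lt,
      (forall x y, x != y -> lt x y || lt y x) & well_founded lt].

Record term_order n := TermOrder {
  to_lt :> rel (term n);
  to_wo : well_order to_lt;
  to_mul : forall w t1 t2 : term n, to_lt t1 t2 -> to_lt (w + t1) (w + t2)
}.

Record mterm_order n m (prec : term_order n) := MtermOrder {
  mo_lt :> rel (mterm n m);
  mo_wo : well_order mo_lt;
  mo_mull : forall (w1 w2 : term n) (t : mterm n m),
    prec w1 w2 -> mo_lt (mtmul w1 t) (mtmul w2 t);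
  mo_mulr : forall (w : term n) (t1 t2 : mterm n m),
    mo_lt t1 t2 -> mo_lt (mtmul w t1) (mtmul w t2)
}.

Definition is_max (T : eqType) (lt : rel T) (P : T -> Prop) (t : T) : Prop :=
  P t /\ forall t', P t' -> (t' == t) || lt t' t.

Lemma is_max_exists (T : eqType) (lt : rel T) (P : T -> Prop) (s : seq T) :
  well_order lt -> (exists t, P t) -> (forall t, P t -> t \in s) ->
  exists t, is_max lt P t.
Proof.
case=> _ tr tot _; elim: s P => [|x s IH] P [t Pt] Ps; first by have := Ps _ Pt.
have [[t1 [Pt1 ne1]]|no] := pselect (exists t1, P t1 /\ t1 != x); last first.
  have Q z : P z -> z = x.
    by move=> Pz; apply/eqP/negPn/negP => ne; apply: no; exists z.
  by exists t; split=> // t' /Q ->; rewrite (Q _ Pt) eqxx.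
have [||y [[Py ney] ymax]] := IH (fun z => P z /\ z != x).
- by exists t1.
- by move=> z [/Ps]; rewrite inE => /orP[->|].
have [Px|nPx] := pselect (P x); last first.
  exists y; split=> // t' Pt'; apply: ymax; split=> //.
  by apply/eqP => E; apply: nPx; rewrite -E.
have /orP[lxy|lyx] := tot _ _ ney.
  exists x; split=> // t' Pt'; have [->|net'] := eqVneq t' x; first by [].
  have /orP[/eqP->|lt'] := ymax t' (conj Pt' net'); first by rewrite lxy orbT.
  by rewrite (tr _ _ _ lt' lxy) orbT.
exists y; split=> // t' Pt'; have [->|net'] := eqVneq t' x; first by rewrite lyx orbT.
exact: ymax.
Qed.

(* Only the restrictions of alpha_i and delta_i to R are data: they are extended
   by alpha_j(Y_i) = Y_i and delta_j(Y_i) = 0, cf. ore_comm below. *)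
Record ore_data (R : nzRingType) (n : nat) := OreData {
  alpha : 'I_n -> {rmorphism R -> R};
  delta : 'I_n -> {additive R -> R};
  alpha_inj : forall i, injective (alpha i);
  delta_der : forall i r s,
    delta i (r * s) = alpha i r * delta i s + delta i r * s;
  alphaC : forall i j r, alpha i (alpha j r) = alpha j (alpha i r);
  deltaC : forall i j r, delta i (delta j r) = delta j (delta i r);
  alpha_deltaC : forall i j r,
    i != j -> alpha j (delta i r) = delta i (alpha j r)
}.

(* R[Y_1; alpha_1, delta_1] ... [Y_n; alpha_n, delta_n] as a left R-module: the
   free module on the terms.  The parameter D selects the multiplication. *)
Definition ore (R : nzRingType) (n : nat) (D : ore_data R n) : Type :=
  {malg R[term n]}.

HB.instance Definition _ R n (D : ore_data R n) :=
  GRing.Lmodule.on (ore D).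

Fact ore_key : unit. Proof. exact: tt. Qed.

Section OreRing.
Variables (R : nzRingType) (n : nat) (D : ore_data R n).
Implicit Types (f g h : ore D) (i j : 'I_n) (t : term n) (r : R).

Definition yexp i : term n := [ffun j => (j == i) : nat].

Lemma yexpE i j : yexp i j = (j == i) :> nat.
Proof. by rewrite ffunE. Qed.

(* left multiplication by Y_i, from Y_i * r = alpha_i(r) Y_i + delta_i(r) *)
Definition ore_lmulY i f : ore D :=
  \sum_(t <- msupp f)
    (<< alpha D i f@_t *g t + yexp i >> + << delta D i f@_t *g t >>).

(* left multiplication by the term Y_1^{t_1} ... Y_n^{t_n} *)
Definition ore_lmulT t f : ore D :=
  foldr (fun i h => iter (t i) (ore_lmulY i) h) f (enum 'I_n).

Definition ore_one : ore D := << 1 *g 0 >>.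

(* Locked, like [tens] and [tens_lift] below, for faster unification. *)
Definition ore_mul : ore D -> ore D -> ore D := locked_with ore_key
  (fun f g => \sum_(t <- msupp f) f@_t *: ore_lmulT t g).

Lemma ore_mulE f g : ore_mul f g = \sum_(t <- msupp f) f@_t *: ore_lmulT t g.
Proof. by rewrite /ore_mul locked_withE. Qed.

Lemma sum_suppw (V : zmodType) (F : R -> term n -> V) (d : {fset (term n)}) f :
  (forall t, F 0 t = 0) -> (msupp f `<=` d)%fset ->
  \sum_(t <- msupp f) F f@_t t = \sum_(t <- d) F f@_t t.
Proof.
move=> F0 sd; rewrite (big_fset_incl _ sd) //= => t _ /mcoeff_outdom ->.
exact: F0.
Qed.

Lemma sum_suppD (V : zmodType) (F : R -> term n -> V) f g :
  (forall a b t, F (a + b) t = F a t + F b t) ->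
  \sum_(t <- msupp (f + g : ore D)) F (f + g)@_t t =
  \sum_(t <- msupp f) F f@_t t + \sum_(t <- msupp g) F g@_t t.
Proof.
move=> FD; have F0 t : F 0 t = 0.
  by apply: (@addrI _ (F 0 t)); rewrite -FD !addr0.
rewrite (@sum_suppw _ F (msupp f `|` msupp g)%fset (f + g)) ?msuppD_le //.
rewrite (@sum_suppw _ F (msupp f `|` msupp g)%fset f) ?fsubsetUl //.
rewrite (@sum_suppw _ F (msupp f `|` msupp g)%fset g) ?fsubsetUr //.
by rewrite -big_split; apply: eq_bigr => t _; rewrite mcoeffD FD.
Qed.

Lemma sum_suppU (V : zmodType) (F : R -> term n -> V) r t :
  (forall t, F 0 t = 0) ->
  \sum_(k <- msupp (<< r *g t >> : ore D)) F (<< r *g t >>)@_k k = F r t.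
Proof.
move=> F0; rewrite (@sum_suppw _ F [fset t]%fset) ?msuppU_le //.
by rewrite big_seq_fset1 mcoeffUU.
Qed.

Lemma ore_ind (P : ore D -> Prop) :
  P 0 -> (forall f g, P f -> P g -> P (f + g)) ->
  (forall r t, P << r *g t >>) -> forall f, P f.
Proof.
by move=> P0 PD PU f; rewrite [f]monalgE; elim/big_ind: _ => // t _; exact: PU.
Qed.

Lemma ore_lmulY_is_additive i : additive (ore_lmulY i).
Proof.
have lD : {morph ore_lmulY i : f g / f + g}.
  move=> f g.
  apply: (@sum_suppD (ore D) (fun r t =>
    << alpha D i r *g t + yexp i >> + << delta D i r *g t >>) f g) => a b t.
  by rewrite !raddfD /= addrACA.
have l0 : ore_lmulY i 0 = 0.
  by apply: (@addrI _ (ore_lmulY i 0)); rewrite -lD !addr0.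
have lN f : ore_lmulY i (- f) = - ore_lmulY i f.
  by apply: (@addrI _ (ore_lmulY i f)); rewrite -lD !subrr l0.
by move=> f g; rewrite lD lN.
Qed.

HB.instance Definition _ i :=
  GRing.isZmodMorphism.Build (ore D) (ore D) (ore_lmulY i)
    (ore_lmulY_is_additive i).

Lemma ore_lmulYD i : {morph ore_lmulY i : f g / f + g}.
Proof. exact: raddfD. Qed.

Lemma ore_lmulYU i r t : ore_lmulY i << r *g t >> =
  << alpha D i r *g t + yexp i >> + << delta D i r *g t >>.
Proof.
apply: (@sum_suppU (ore D) (fun r t =>
    << alpha D i r *g t + yexp i >> + << delta D i r *g t >>)) => k.
by rewrite !raddf0 addr0.
Qed.

Lemma malgZU (K : choiceType) r s (t : K) :
  r *: (<< s *g t >> : {malg R[K]}) = << r * s *g t >>.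
Proof. by apply/malgP=> k; rewrite mcoeffZ !mcoeffU mulrnAr. Qed.

Lemma ore_lmulYZ i r f :
  ore_lmulY i (r *: f) = alpha D i r *: ore_lmulY i f + delta D i r *: f.
Proof.
elim/ore_ind: f => [|f g Hf Hg|s t]; first by rewrite !(scaler0, raddf0) addr0.
  by rewrite scalerDr !ore_lmulYD Hf Hg !scalerDr addrACA.
rewrite (malgZU r s t) !ore_lmulYU delta_der rmorphM scalerDr.
by rewrite (malgZU _ _ (t + _)) !(malgZU _ _ t) monalgUD addrA.
Qed.

Lemma ore_lmulYC i j f :
  ore_lmulY i (ore_lmulY j f) = ore_lmulY j (ore_lmulY i f).
Proof.
have [->//|ij] := eqVneq i j.
elim/ore_ind: f => [|f g Hf Hg|s t]; first by rewrite !raddf0.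
  by rewrite !ore_lmulYD Hf Hg.
rewrite !ore_lmulYU !ore_lmulYD !ore_lmulYU.
rewrite (alphaC D i j) (deltaC D i j) (alpha_deltaC D s ij).
rewrite (alpha_deltaC D s (i := j) (j := i)) 1?eq_sym //.
have -> : t + yexp i + yexp j = t + yexp j + yexp i by rewrite addrAC.
exact: addrACA.
Qed.

Lemma ore_lmulT_is_additive t : additive (ore_lmulT t).
Proof.
rewrite /ore_lmulT => f g; elim: (enum _) => //= i s ->.
by elim: (t i) => //= k ->; rewrite raddfB.
Qed.

HB.instance Definition _ t :=
  GRing.isZmodMorphism.Build (ore D) (ore D) (ore_lmulT t)
    (ore_lmulT_is_additive t).

Lemma iter_lmulYC i j k f :
  ore_lmulY i (iter k (ore_lmulY j) f) = iter k (ore_lmulY j) (ore_lmulY i f).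
Proof. by elim: k => //= k <-; rewrite ore_lmulYC. Qed.

Lemma ore_lmulYT i t f : ore_lmulY i (ore_lmulT t f) = ore_lmulT (t + yexp i) f.
Proof.
pose P s u := foldr (fun i h => iter (u i) (ore_lmulY i) h) f s.
have Pout s : i \notin s -> P s (t + yexp i) = P s t.
  elim: s => //= j s IH; rewrite inE negb_or => /andP[ij /IH ->].
  by rewrite termDE yexpE eq_sym (negPf ij) addn0.
suff Pin s : uniq s -> i \in s -> ore_lmulY i (P s t) = P s (t + yexp i).
  by apply: Pin; rewrite ?enum_uniq ?mem_enum.
elim: s => //= j s IH /andP[js us]; rewrite inE.
case: (eqVneq i j) => [eij _|ij /= si].
  by rewrite -eij in js *; rewrite Pout // termDE yexpE eqxx addn1.
by rewrite iter_lmulYC IH // termDE yexpE eq_sym (negPf ij) addn0.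
Qed.

Lemma ore_lmulT0 f : ore_lmulT 0 f = f.
Proof. by rewrite /ore_lmulT; elim: (enum _) => //= i s ->; rewrite term0E. Qed.

Lemma ore_lmulTT t1 t2 f :
  ore_lmulT t1 (ore_lmulT t2 f) = ore_lmulT (t1 + t2) f.
Proof.
pose P s h := foldr (fun i h => iter (t1 i) (ore_lmulY i) h) h s.
pose E (s : seq 'I_n) : term n := [ffun i => if i \in s then t1 i else 0%N].
suff PE s : uniq s -> P s (ore_lmulT t2 f) = ore_lmulT (E s + t2) f.
  rewrite {1}/ore_lmulT -/(P _ _) PE ?enum_uniq //; congr (ore_lmulT (_ + _) _).
  by apply: eq_term => i; rewrite ffunE mem_enum.
elim: s => [_|i s IH /= /andP[is_ us]].
  by congr ore_lmulT; apply: eq_term => i; rewrite termDE ffunE.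
have iterU k (t : term n) : iter k (ore_lmulY i) (ore_lmulT t f) =
    ore_lmulT (([ffun j => (j == i) * k]%N : term n) + t) f.
  elim: k => /= [|k ->].
    congr ore_lmulT; apply: eq_term => j.
    by rewrite termDE ffunE muln0 add0n.
  rewrite ore_lmulYT; congr ore_lmulT; apply: eq_term => j.
  by rewrite !termDE yexpE !ffunE mulnS addnAC (addnC (j == i)).
rewrite IH // iterU; congr ore_lmulT; apply: eq_term => j.
rewrite !termDE !ffunE inE addnA.
have [->|ji] := eqVneq j i; first by rewrite (negPf is_) mul1n addn0.
by rewrite mul0n add0n.
Qed.

Lemma ore_mulUl r t g : ore_mul << r *g t >> g = r *: ore_lmulT t g.
Proof.
rewrite ore_mulE; apply: (@sum_suppU (ore D) (fun r t => r *: ore_lmulT t g)).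
by move=> k; rewrite scale0r.
Qed.

Lemma ore_mulDl : left_distributive ore_mul +%R.
Proof.
move=> f h g; rewrite !ore_mulE; apply: (@sum_suppD (ore D) (fun r t => r *: ore_lmulT t g)).
by move=> a b t; rewrite scalerDl.
Qed.

Lemma ore_mulDr : right_distributive ore_mul +%R.
Proof.
move=> f g h; rewrite !ore_mulE -big_split; apply: eq_bigr => t _ /=.
by rewrite raddfD /= scalerDr.
Qed.

Lemma ore_mul0r f : ore_mul 0 f = 0.
Proof. by rewrite ore_mulE msupp0 big_seq_fset0. Qed.

Lemma ore_mul1r : left_id ore_one ore_mul.
Proof. by move=> f; rewrite ore_mulUl scale1r ore_lmulT0. Qed.

Lemma delta1 i : delta D i 1 = 0.
Proof.
have := delta_der D i 1 1; rewrite !mulr1 rmorph1 mul1r => E.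
by apply: (@addrI _ (delta D i 1)); rewrite -E addr0.
Qed.

Lemma ore_lmulTU1 t : ore_lmulT t ore_one = << 1 *g t >>.
Proof.
pose P s : ore D := foldr (fun i h => iter (t i) (ore_lmulY i) h) ore_one s.
pose E (s : seq 'I_n) : term n := [ffun i => if i \in s then t i else 0%N].
suff PE s : uniq s -> P s = << 1 *g E s >>.
  rewrite /ore_lmulT -/(P _) PE ?enum_uniq //.
  by congr << _ *g _ >>; apply: eq_term => i; rewrite ffunE mem_enum.
elim: s => [_|i s IH /= /andP[is_ us]].
  by congr << _ *g _ >>; apply: eq_term => i; rewrite term0E ffunE.
have iterU k (u : term n) : iter k (ore_lmulY i) << 1 *g u >> =
    << 1 *g u + [ffun j => (j == i) * k]%N >>.
  elim: k => /= [|k ->].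
    congr << _ *g _ >>; apply: eq_term => j.
    by rewrite termDE ffunE muln0 addn0.
  rewrite ore_lmulYU rmorph1 delta1 monalgU0 addr0.
  congr << _ *g _ >>; apply: eq_term => j.
  by rewrite !termDE yexpE !ffunE mulnS (addnC (j == i)) addnA.
rewrite IH // iterU; congr << _ *g _ >>; apply: eq_term => j.
rewrite termDE !ffunE inE.
have [->|ji] := eqVneq j i; first by rewrite (negPf is_) mul1n.
by rewrite mul0n addn0.
Qed.

Lemma ore_mulr1 : right_id ore_one ore_mul.
Proof.
move=> f; rewrite [RHS](monalgE (f : {malg R[term n]})) ore_mulE.
by apply: eq_bigr => t _; rewrite ore_lmulTU1 malgZU mulr1.
Qed.

Lemma ore_scaleAl r f g : ore_mul (r *: f) g = r *: ore_mul f g.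
Proof.
elim/ore_ind: f => [|f h Hf Hh|s t]; first by rewrite scaler0 !ore_mul0r scaler0.
  by rewrite scalerDr !ore_mulDl Hf Hh scalerDr.
by rewrite (malgZU r s t) !ore_mulUl scalerA.
Qed.

Lemma ore_lmulYM i f g : ore_lmulY i (ore_mul f g) = ore_mul (ore_lmulY i f) g.
Proof.
elim/ore_ind: f => [|f h Hf Hh|s t].
- by rewrite !(raddf0, ore_mul0r).
- by rewrite ore_mulDl !ore_lmulYD Hf Hh ore_mulDl.
by rewrite ore_mulUl ore_lmulYU ore_mulDl !ore_mulUl ore_lmulYZ ore_lmulYT.
Qed.

Lemma ore_lmulTM t f g : ore_lmulT t (ore_mul f g) = ore_mul (ore_lmulT t f) g.
Proof.
rewrite /ore_lmulT; elim: (enum _) => //= i s ->.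
by elim: (t i) => //= k ->; rewrite ore_lmulYM.
Qed.

Lemma ore_mulA : associative ore_mul.
Proof.
move=> f g h; elim/ore_ind: f => [|f k Hf Hk|s t]; first by rewrite !ore_mul0r.
  by rewrite !ore_mulDl Hf Hk.
by rewrite !ore_mulUl ore_scaleAl ore_lmulTM.
Qed.

Lemma ore_one_neq0 : ore_one != 0.
Proof. by rewrite monalgU_eq0 oner_eq0. Qed.

End OreRing.

HB.instance Definition _ R n (D : ore_data R n) :=
  GRing.Zmodule_isNzRing.Build (ore D)
    (@ore_mulA R n D) (@ore_mul1r R n D) (@ore_mulr1 R n D)
    (@ore_mulDl R n D) (@ore_mulDr R n D) (@ore_one_neq0 R n D).

Section OreTheory.
Variables (R : nzRingType) (n : nat) (D : ore_data R n).
Implicit Types (f g h : ore D) (i j : 'I_n) (t u : term n) (a b r : R).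

Lemma oreE f g : f * g = ore_mul f g. Proof. by []. Qed.

Lemma oreC_mul r f : (<< r *g 0 >> : ore D) * f = r *: f.
Proof. by rewrite oreE ore_mulUl ore_lmulT0. Qed.

Lemma ore_lmulT_yexp i f : ore_lmulT (yexp i) f = ore_lmulY i f.
Proof. by rewrite -[yexp i]add0r -ore_lmulYT ore_lmulT0. Qed.

Lemma oreY_mul i f : (<< 1 *g yexp i >> : ore D) * f = ore_lmulY i f.
Proof. by rewrite oreE ore_mulUl scale1r ore_lmulT_yexp. Qed.

Lemma ore_mulU1 r t u :
  (<< r *g t >> : ore D) * << 1 *g u >> = << r *g t + u >>.
Proof.
rewrite oreE ore_mulUl -[<< 1 *g u >>]ore_lmulTU1 ore_lmulTT ore_lmulTU1.
by rewrite malgZU mulr1.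
Qed.

Definition ore_map (p : R -> R) f : ore D := \sum_(t <- msupp f) << p f@_t *g t >>.

(* Y_i * f = alpha_i(f) Y_i + delta_i(f), where alpha_i and delta_i act on the
   coefficients of f and thus fix, resp. kill, every Y_j: this is the iterated
   Ore extension. *)
Lemma ore_comm i f : (<< 1 *g yexp i >> : ore D) * f =
  ore_map (alpha D i) f * << 1 *g yexp i >> + ore_map (delta D i) f.
Proof.
rewrite oreY_mul /ore_lmulY /ore_map big_split; congr (_ + _).
by rewrite mulr_suml; apply: eq_bigr => t _; rewrite ore_mulU1.
Qed.

Definition alphaT t r : R :=
  foldr (fun i x => iter (t i) (alpha D i) x) r (enum 'I_n).

Fact graded_der i r s : (\0 : R -> R) (r * s) =
  alpha D i r * (\0 : R -> R) s + (\0 : R -> R) r * s.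
Proof. by rewrite /= mulr0 mul0r addr0. Qed.

Fact graded_alpha_deltaC i j r : i != j ->
  alpha D j ((\0 : R -> R) r) = (\0 : R -> R) (alpha D j r).
Proof. by rewrite /= raddf0. Qed.

Definition graded : ore_data R n := {|
  alpha := alpha D;
  delta := fun=> \0;
  alpha_inj := @alpha_inj _ _ D;
  delta_der := graded_der;
  alphaC := @alphaC _ _ D;
  deltaC := fun _ _ _ => erefl;
  alpha_deltaC := graded_alpha_deltaC
|}.

Definition hatR : set R :=
  [set a | forall h, (<< a *g 0 >> : ore D) * h = h * << a *g 0 >>].

Lemma hatRY a i : hatR a -> alpha D i a = a /\ delta D i a = 0.
Proof.
move=> /(_ (<< 1 *g yexp i >>)); rewrite oreC_mul oreY_mul ore_lmulYU malgZU.
rewrite mulr1 add0r => /malgP E.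
have ne : yexp i != 0.
  by apply/eqP => /(congr1 (fun t : term n => t i)); rewrite yexpE term0E eqxx.
have := E (yexp i); rewrite mcoeffD !mcoeffU eqxx eq_sym (negPf ne) addr0 !mulr1n.
move=> <-; split=> //.
by have := E 0; rewrite mcoeffD !mcoeffU eqxx (negPf ne) add0r mulr1n mulr0n.
Qed.

Lemma hatR_comm a r : hatR a -> a * r = r * a.
Proof.
move=> /(_ (<< r *g 0 >>)); rewrite !oreC_mul !malgZU => /malgP/(_ 0).
by rewrite !mcoeffUU.
Qed.

Lemma hatR_scaleAr a f g : hatR a -> f * (a *: g) = a *: (f * g).
Proof. by move=> ha; rewrite -!oreC_mul !mulrA ha. Qed.

Lemma hatR_scaleAl a f g : (a *: f) * g = a *: (f * g).
Proof. exact: ore_scaleAl. Qed.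

End OreTheory.

Section Graded.
Variables (R : nzRingType) (n : nat) (D : ore_data R n).
Local Notation S := (ore (graded D)).

Lemma graded_mulUU (a b : R) (t u : term n) :
  (<< a *g t >> : S) * << b *g u >> = << a * alphaT D t b *g t + u >>.
Proof.
rewrite oreE ore_mulUl.
suff -> : ore_lmulT t (<< b *g u >> : S) = << alphaT D t b *g t + u >>.
  by rewrite malgZU.
rewrite -[<< b *g u >>]/(<< b *g u >> : S).
have -> : (<< b *g u >> : S) = b *: << 1 *g u >> by rewrite malgZU mulr1.
have lZ r (f : S) : ore_lmulT t (r *: f) = alphaT D t r *: ore_lmulT t f.
  rewrite /ore_lmulT /alphaT; elim: (enum _) => //= i s ->.
  elim: (t i) => //= k ->.
  by rewrite ore_lmulYZ /= scale0r addr0.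
rewrite lZ -[<< 1 *g u >>]ore_lmulTU1 ore_lmulTT ore_lmulTU1.
by rewrite malgZU mulr1.
Qed.

Lemma hatR_graded : hatR D `<=` hatR (graded D).
Proof.
move=> a ha h; rewrite oreC_mul.
elim/ore_ind: h => [|f g Hf Hg|s t]; first by rewrite scaler0 mul0r.
  by rewrite scalerDr Hf Hg mulrDl.
rewrite malgZU graded_mulUU addr0; congr << _ *g _ >>.
suff -> : alphaT D t a = a by exact: hatR_comm ha.
rewrite /alphaT; elim: (enum _) => //= i l ->.
by elim: (t i) => //= k ->; case: (hatRY i ha).
Qed.

End Graded.

(* For a subset C of R, [tensor C V W] is V (x)_C W: the free abelian group on
   V * W modulo biadditivity and (c v, w) = (v, c w) for c in C.  Applied to
   C = hatR D and V = W = ore D it is R (x)_hatR R^op; elements of hatR D being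
   central, they scale R^op as they scale R. *)
Section Tensor.
Variables (R : nzRingType) (C : set R) (V W : lmodType R).
Local Notation free := {malg int[(V * W)%type]}.

Inductive tens_rel : free -> Prop :=
| TensRel0 : tens_rel 0
| TensRelB x y : tens_rel x -> tens_rel y -> tens_rel (x - y)
| TensRelDl v v' w :
    tens_rel (<< (v + v', w) >> - << (v, w) >> - << (v', w) >>)
| TensRelDr v w w' :
    tens_rel (<< (v, w + w') >> - << (v, w) >> - << (v, w') >>)
| TensRelZ c v w : C c -> tens_rel (<< (c *: v, w) >> - << (v, c *: w) >>).

Definition tens_null : pred free := fun x => `[< tens_rel x >].

Fact tens_null_zmod : zmod_closed tens_null.
Proof.
split; first by apply/asboolP; exact: TensRel0.
by move=> x y /asboolP hx /asboolP hy; apply/asboolP; exact: TensRelB.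
Qed.
HB.instance Definition _ := GRing.isZmodClosed.Build free tens_null tens_null_zmod.

Definition tensor : Type :=
  Quotient.quot (GRing.ZmodClosed.clone free tens_null _).
HB.instance Definition _ := GRing.Zmodule.on tensor.

Definition tens_pi (x : free) : tensor := \pi_tensor%qT x.
Definition tens : V -> W -> tensor :=
  locked_with ore_key (fun v w => tens_pi << (v, w) >>).
Lemma tensE v w : tens v w = tens_pi << (v, w) >>.
Proof. by rewrite /tens locked_withE. Qed.

(* the map V (x)_C W -> Z induced by p; meaningful for balanced p,
   cf. tens_liftE *)
Definition free_lift (Z : zmodType) (p : V -> W -> Z) (x : free) : Z :=
  \sum_(k <- msupp x) p k.1 k.2 *~ x@_k.
Definition tens_lift (Z : zmodType) : (V -> W -> Z) -> tensor -> Z :=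
  locked_with ore_key (fun p t => free_lift p (repr t)).

Definition balanced (Z : zmodType) (p : V -> W -> Z) : Prop :=
  [/\ forall v v' w, p (v + v') w = p v w + p v' w,
      forall v w w', p v (w + w') = p v w + p v w' &
      forall c v w, C c -> p (c *: v) w = p v (c *: w)].

Lemma tens_piB x y : tens_pi (x - y) = tens_pi x - tens_pi y.
Proof.
rewrite /tens_pi.
rewrite (raddfB (\pi_(Quotient.quot (GRing.ZmodClosed.clone free tens_null _)))%qT).
by [].
Qed.

Lemma tens_pi0 : tens_pi 0 = 0.
Proof. by have := tens_piB 0 0; rewrite !subrr. Qed.

Lemma tens_piD x y : tens_pi (x + y) = tens_pi x + tens_pi y.
Proof. by have := tens_piB x (0 - y); rewrite (tens_piB 0 y) tens_pi0 !sub0r !opprK. Qed.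

Lemma tens_piK t : tens_pi (repr t) = t.
Proof. exact: reprK. Qed.

Lemma tens_piP x y : tens_pi x = tens_pi y <-> tens_rel (x - y).
Proof.
have E : tens_null (x - y) = (tens_pi x == tens_pi y) :=
  Quotient.idealrBE (GRing.ZmodClosed.clone free tens_null _) x y.
split=> [/eqP|/asboolP h]; first by rewrite -E => /asboolP.
by apply/eqP; rewrite -E.
Qed.

Lemma tens_rel_eq x y z : tens_rel (x - y - z) -> tens_pi x = tens_pi y + tens_pi z.
Proof. by move=> h; rewrite -tens_piD; apply/tens_piP; rewrite opprD addrA. Qed.

Lemma tensDl v v' w : tens (v + v') w = tens v w + tens v' w.
Proof. rewrite !tensE; exact/tens_rel_eq/TensRelDl. Qed.

Lemma tensDr v w w' : tens v (w + w') = tens v w + tens v w'.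
Proof. rewrite !tensE; exact/tens_rel_eq/TensRelDr. Qed.

Lemma tensZ c v w : C c -> tens (c *: v) w = tens v (c *: w).
Proof. by move=> hc; rewrite !tensE; apply/tens_piP; exact: TensRelZ. Qed.

Lemma tens_balanced : balanced tens.
Proof. by split; [exact: tensDl|exact: tensDr|exact: tensZ]. Qed.

Lemma tens0l w : tens 0 w = 0.
Proof. by apply: (@addrI _ (tens 0 w)); rewrite -tensDl !addr0. Qed.

Lemma tens0r v : tens v 0 = 0.
Proof. by apply: (@addrI _ (tens v 0)); rewrite -tensDr !addr0. Qed.

Lemma tensNl v w : tens (- v) w = - tens v w.
Proof. by apply: (@addrI _ (tens v w)); rewrite -tensDl !subrr tens0l. Qed.

Lemma tens_ind (P : tensor -> Prop) :
  P 0 -> (forall t1 t2, P t1 -> P t2 -> P (t1 + t2)) ->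
  (forall v w, P (tens v w)) -> forall t, P t.
Proof.
move=> P0 PD PT t; rewrite -[t]tens_piK; move: (repr t) => {t} x.
rewrite [x]monalgE; elim/big_ind: _ => [|y z Py Pz|[v w] _].
- by rewrite tens_pi0.
- by rewrite tens_piD; exact: PD.
move: (x@_(v, w)) => {x} k.
have PN t : P t -> P (- t) -> forall k : nat, P (t *+ k) /\ P (- (t *+ k)).
  move=> h1 h2; elim=> [|j [IH1 IH2]]; first by rewrite mulr0n oppr0.
  by rewrite mulrS opprD; split; exact: PD.
have Pn (j : nat) : tens_pi << j%:Z *g (v, w) >> = tens v w *+ j.
  rewrite tensE; elim: j => [|j IH]; first by rewrite monalgU0 tens_pi0.
  by rewrite intS monalgUD tens_piD IH mulrS.
have [|h1 h2] := PN (tens v w) (PT v w) _ (`|k|)%N; first by rewrite -tensNl.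
case: (intP k) h1 h2 => [|j|j] h1 h2.
- by rewrite (Pn 0).
- by rewrite (Pn j.+1).
rewrite monalgUN -sub0r tens_piB tens_pi0 sub0r.
by move: h2; rewrite abszN (Pn j.+1).
Qed.

Lemma free_liftD (Z : zmodType) (p : V -> W -> Z) x y :
  free_lift p (x + y) = free_lift p x + free_lift p y.
Proof.
have sw (d : {fset (V * W)%type}) z : (msupp z `<=` d)%fset ->
    free_lift p z = \sum_(k <- d) p k.1 k.2 *~ z@_k.
  move=> sd; rewrite /free_lift (big_fset_incl _ sd) //= => k _ /mcoeff_outdom ->.
  by rewrite mulr0z.
rewrite (sw (msupp x `|` msupp y)%fset (x + y)) ?msuppD_le //.
rewrite (sw (msupp x `|` msupp y)%fset x) ?fsubsetUl //.
rewrite (sw (msupp x `|` msupp y)%fset y) ?fsubsetUr //.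
by rewrite -big_split; apply: eq_bigr => k _; rewrite mcoeffD mulrzDr.
Qed.

Lemma free_liftB (Z : zmodType) (p : V -> W -> Z) x y :
  free_lift p (x - y) = free_lift p x - free_lift p y.
Proof.
by apply: (@addIr _ (free_lift p y)); rewrite -free_liftD !subrK.
Qed.

Lemma free_liftU (Z : zmodType) (p : V -> W -> Z) v w :
  free_lift p << (v, w) >> = p v w.
Proof.
by rewrite /free_lift msuppU oner_eq0 big_seq_fset1 mcoeffUU.
Qed.

Section Lift.
Variables (Z : zmodType) (p : V -> W -> Z).
Hypothesis bp : balanced p.

Lemma tens_lift_pi x : tens_lift p (tens_pi x) = free_lift p x.
Proof.
apply/eqP; rewrite /tens_lift locked_withE -subr_eq0 -free_liftB; apply/eqP.
have : tens_rel (repr (tens_pi x) - x) by apply/tens_piP; rewrite tens_piK.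
case: bp => bl br bz; elim=> {x} [|x y _ hx _ hy|v v' w|v w w'|c v w hc].
- by rewrite -[X in free_lift _ X](subrr 0) free_liftB subrr.
- by rewrite free_liftB hx hy subr0.
- by rewrite !free_liftB !free_liftU bl addrAC addrK subrr.
- by rewrite !free_liftB !free_liftU br addrAC addrK subrr.
by rewrite !free_liftB !free_liftU bz ?subrr.
Qed.

Lemma tens_liftE v w : tens_lift p (tens v w) = p v w.
Proof. by rewrite tensE tens_lift_pi free_liftU. Qed.

Lemma tens_liftD t1 t2 : tens_lift p (t1 + t2) = tens_lift p t1 + tens_lift p t2.
Proof.
rewrite -{1}[t1]tens_piK -{1}[t2]tens_piK -tens_piD tens_lift_pi free_liftD.
by rewrite -!tens_lift_pi !tens_piK.
Qed.

Lemma tens_lift0 : tens_lift p 0 = 0.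
Proof. by apply: (@addrI _ (tens_lift p 0)); rewrite -tens_liftD !addr0. Qed.

End Lift.

End Tensor.

Record nonzero (V : zmodType) := Nonzero { nz_val :> V; nz_neq0 : nz_val != 0 }.
Arguments Nonzero {V}.

Section Groebner.
Variables (R : nzRingType) (n : nat) (D : ore_data R n) (m u : nat).

(* both R^m and S^m *)
Definition ore_mod : zmodType := {ffun 'I_m -> ore D}.

Definition ore_act (x : ore D) (f : ore_mod) (y : ore D) : ore_mod :=
  [ffun i => x * f i * y].

Definition gr_mul (x y : ore D) : ore D := (x : ore (graded D)) * y.

Definition gr_act (x : ore D) (f : ore_mod) (y : ore D) : ore_mod :=
  [ffun i => gr_mul (gr_mul x (f i)) y].

Definition bispan (V : zmodType) (act : ore D -> V -> ore D -> V) (E : set V) :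
    set V :=
  [set f | exists (N : nat) (x y : 'I_N -> ore D) (e : 'I_N -> V),
    (forall i, E (e i)) /\ f = \sum_(i < N) act (x i) (e i) (y i)].

Local Notation tens_ore := (tensor (hatR D) (ore D) (ore D)).
Local Notation "v *t w" := (@tens R (hatR D) (ore D) (ore D) v w)
  (at level 40, left associativity).

(* both (R (x)_hatR R^op)^u and (S (x)_hatR S^op)^u; lambda e_l rho is the
   family whose only nonzero entry is lambda (x) rho, at l *)
Definition syz_mod : zmodType := {ffun 'I_u -> tens_ore}.

(* the S-bimodule structure: x (v (x) w) y = xv (x) wy *)
Definition syz_gr_act (x : ore D) (s : syz_mod) (y : ore D) : syz_mod :=
  [ffun l => tens_lift (fun v w => gr_mul x v *t gr_mul w y) (s l)].

(* v (x) w |-> (v_lam lam) (x) (w_rho rho) *)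
Definition tens_comp (lam rho : term n) : tens_ore -> tens_ore :=
  tens_lift (fun v w => << v@_lam *g lam >> *t << w@_rho *g rho >>).

Definition syz_comp (k : term n * 'I_u * term n) (s : syz_mod) : syz_mod :=
  let: (lam, l, rho) := k in
  [ffun j => if j == l then tens_comp lam rho (s l) else 0].

Lemma gr_mulDl x y z : gr_mul (x + y) z = gr_mul x z + gr_mul y z.
Proof. exact: (@mulrDl (ore (graded D))). Qed.
Lemma gr_mulDr x y z : gr_mul x (y + z) = gr_mul x y + gr_mul x z.
Proof. exact: (@mulrDr (ore (graded D))). Qed.
Lemma gr_mulZl c x y : gr_mul (c *: x) y = c *: gr_mul x y.
Proof. exact: (@hatR_scaleAl R n (graded D)). Qed.
Lemma gr_mulZr c x y : hatR D c -> gr_mul x (c *: y) = c *: gr_mul x y.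
Proof. by move=> /hatR_graded; exact: hatR_scaleAr. Qed.

Lemma ore_act_balanced f :
  @balanced R (hatR D) (ore D) (ore D) _ (fun v w => ore_act v f w).
Proof.
split=> [v v' w|v w w'|c v w hc]; apply/ffunP => i; rewrite !ffunE.
- by rewrite !mulrDl.
- by rewrite !mulrDr.
by rewrite !hatR_scaleAl hatR_scaleAr.
Qed.

Lemma gr_act_balanced f :
  @balanced R (hatR D) (ore D) (ore D) _ (fun v w => gr_act v f w).
Proof.
split=> [v v' w|v w w'|c v w hc]; apply/ffunP => i; rewrite !ffunE.
- by rewrite !gr_mulDl.
- by rewrite !gr_mulDr.
by rewrite !gr_mulZl gr_mulZr.
Qed.

Lemma syz_gr_act_balanced x y : @balanced R (hatR D) (ore D) (ore D) _
  (fun v w => gr_mul x v *t gr_mul w y).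
Proof.
split=> [v v' w|v w w'|c v w hc].
- by rewrite gr_mulDr tensDl.
- by rewrite gr_mulDl tensDr.
by rewrite gr_mulZr // gr_mulZl tensZ.
Qed.

Lemma tens_comp_balanced lam rho : @balanced R (hatR D) (ore D) (ore D) _
  (fun v w => << v@_lam *g lam >> *t << w@_rho *g rho >>).
Proof.
split=> [v v' w|v w w'|c v w hc].
- by rewrite mcoeffD monalgUD tensDl.
- by rewrite mcoeffD monalgUD tensDr.
by rewrite !mcoeffZ -!malgZU tensZ.
Qed.

Lemma tens_comp_fin (t : tens_ore) : exists L : {fset (term n)},
  (forall lam rho, tens_comp lam rho t != 0 -> (lam \in L) && (rho \in L)) /\
  t = \sum_(lam <- L) \sum_(rho <- L) tens_comp lam rho t.
Proof.
suff [L HL] : exists L : {fset (term n)},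
    (forall lam rho, tens_comp lam rho t != 0 -> (lam \in L) && (rho \in L)) /\
    forall L', (L `<=` L')%fset ->
      t = \sum_(lam <- L') \sum_(rho <- L') tens_comp lam rho t.
  by exists L; case: HL => H1 H2; split=> //; apply: H2.
elim/tens_ind: t => [|t1 t2 [L1 [S1 E1]] [L2 [S2 E2]]|v w].
- exists fset0; split=> [lam rho|L' _].
    by rewrite /tens_comp (tens_lift0 (tens_comp_balanced _ _)) eqxx.
  rewrite big1 // => lam _; rewrite big1 // => rho _.
  by rewrite /tens_comp (tens_lift0 (tens_comp_balanced _ _)).
- have D12 lam rho : tens_comp lam rho (t1 + t2) =
      tens_comp lam rho t1 + tens_comp lam rho t2.
    exact: (tens_liftD (tens_comp_balanced _ _)).
  exists (L1 `|` L2)%fset; split=> [lam rho|L'].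
    rewrite D12 !inE; have [->|/S1/andP[-> ->]//] := eqVneq (tens_comp lam rho t1) 0.
    by rewrite add0r => /S2 /andP[-> ->]; rewrite !orbT.
  rewrite fsubUset => /andP[s1 s2]; rewrite {1}(E1 _ s1) {1}(E2 _ s2) -big_split.
  by apply: eq_bigr => lam _; rewrite -big_split; apply: eq_bigr => rho _; rewrite D12.
have C lam rho : tens_comp lam rho (v *t w) =
    << v@_lam *g lam >> *t << w@_rho *g rho >>.
  exact: (tens_liftE (tens_comp_balanced _ _)).
exists (msupp v `|` msupp w)%fset; split=> [lam rho|L'].
  rewrite C !inE -!mcoeff_neq0.
  have [->|_] := eqVneq v@_lam 0; first by rewrite monalgU0 tens0l eqxx.
  have [->|_] := eqVneq w@_rho 0; first by rewrite monalgU0 tens0r eqxx.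
  by rewrite orbT.
rewrite fsubUset => /andP[sv sw].
rewrite {1}(monalgEw sv) {1}(monalgEw sw).
have sl (I : Type) (r : seq I) (F : I -> ore D) z :
    (\sum_(i <- r) F i) *t z = \sum_(i <- r) F i *t z.
  by apply: (big_morph (fun x => x *t z)) => [x y|]; rewrite (tensDl, tens0l).
have sr (I : Type) (r : seq I) (F : I -> ore D) z :
    z *t (\sum_(i <- r) F i) = \sum_(i <- r) z *t F i.
  by apply: (big_morph (fun x => z *t x)) => [x y|]; rewrite (tensDr, tens0r).
rewrite sl; apply: eq_bigr => lam _; rewrite sr; apply: eq_bigr => rho _.
by rewrite C.
Qed.

Lemma syz_compE lam l rho s :
  (syz_comp (lam, l, rho) s == 0) = (tens_comp lam rho (s l) == 0).
Proof.
apply/eqP/eqP => [/ffunP/(_ l)|E]; first by rewrite !ffunE eqxx.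
by apply/ffunP => j; rewrite !ffunE E if_same.
Qed.

Lemma syz_comp_supp (s : syz_mod) : exists K : seq (term n * 'I_u * term n),
  forall k, syz_comp k s != 0 -> k \in K.
Proof.
have /choice[L HL] := fun l => tens_comp_fin (s l).
pose T := flatten [seq (L l : seq (term n)) | l <- enum 'I_u].
exists [seq (q, rho) | q <- [seq (lam, l) | lam <- T, l <- enum 'I_u], rho <- T].
case=> [[lam l] rho]; rewrite syz_compE => /(proj1 (HL l)) /andP[h1 h2].
have LT x : x \in L l -> x \in T.
  by move=> hx; apply/flatten_mapP; exists l; rewrite ?mem_enum.
by apply: allpairs_f; [apply: allpairs_f; rewrite ?mem_enum //; exact: LT|exact: LT].
Qed.

Lemma syz_comp_finite (s : syz_mod) : finite_set [set k | syz_comp k s != 0].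
Proof.
have [K HK] := syz_comp_supp s.
by apply: (@sub_finite_set _ _ [set` K]) => //; exact: HK.
Qed.

Lemma syz_comp_neq0 (s : syz_mod) : s != 0 -> exists k, syz_comp k s != 0.
Proof.
move=> s0; apply: contrapT => no; case/negP: s0; apply/eqP/ffunP => l.
rewrite ffunE; have [L [_ ->]] := tens_comp_fin (s l).
rewrite big1 // => lam _; rewrite big1 // => rho _.
by apply: contrapT => /eqP h; apply: no; exists (lam, l, rho); rewrite syz_compE.
Qed.

Definition mcoef (f : ore_mod) (t : mterm n m) : R := (f t.2)@_t.1.

Section Order.
Variables (prec : term_order n) (lt : mterm_order m prec).

Lemma lterm_exists (f : nonzero ore_mod) :
  exists t, is_max lt (fun t => mcoef f t != 0) t.
Proof.
pose s := [seq (t, i) | i <- enum 'I_m, t <- msupp (nz_val f i)].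
apply: (is_max_exists (s := s)); first exact: mo_wo.
  apply: contrapT => no; case/negP: (nz_neq0 f); apply/eqP/ffunP => i.
  apply/malgP => t; rewrite ffunE mcoeff0; apply: contrapT => /eqP h.
  by apply: no; exists (t, i).
case=> t i; rewrite /mcoef mcoeff_neq0 /= => ht.
by apply/allpairsPdep; exists i, t; rewrite mem_enum.
Qed.

Definition lterm (f : nonzero ore_mod) : mterm n m := sval (cid (lterm_exists f)).
Definition lcoef (f : nonzero ore_mod) : R := mcoef f (lterm f).
Definition lmon (f : nonzero ore_mod) : ore_mod :=
  [ffun i => if i == (lterm f).2 then << lcoef f *g (lterm f).1 >> else 0].

Definition mle (t1 t2 : mterm n m) : bool := (t1 == t2) || lt t1 t2.

Section Family.
Variable g : 'I_u -> nonzero ore_mod.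

Definition tdeg (k : term n * 'I_u * term n) : mterm n m :=
  let: (lam, l, rho) := k in
  (lam + (lterm (g l)).1 + rho, (lterm (g l)).2).

(* a lambda e_l b rho *)
Record bterm := BTerm {
  bt_a : R; bt_lam : term n; bt_l : 'I_u; bt_b : R; bt_rho : term n;
  bt_a_neq0 : bt_a != 0; bt_b_neq0 : bt_b != 0
}.

Definition bt_deg (p : bterm) : mterm n m := tdeg (bt_lam p, bt_l p, bt_rho p).

(* f = \sum_i a_i lambda_i h_(l_i) b_i rho_i for the action act, each
   a_i lambda_i (...)_(l_i) b_i rho_i being of a degree that satisfies P *)
Definition represented (act : ore D -> ore_mod -> ore D -> ore_mod)
    (h : 'I_u -> ore_mod) (P : mterm n m -> Prop) (f : ore_mod) : Prop :=
  exists (N : nat) (p : 'I_N -> bterm), (forall i, P (bt_deg (p i))) /\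
    f = \sum_(i < N) act << bt_a (p i) *g bt_lam (p i) >> (h (bt_l (p i)))
                         << bt_b (p i) *g bt_rho (p i) >>.

Definition bimod : set ore_mod :=
  bispan ore_act (range (fun l => g l : ore_mod)).

Definition weak_groebner_basis : Prop :=
  forall f : nonzero ore_mod, bimod f ->
    represented gr_act (fun l => lmon (g l)) (fun t => t = lterm f) (lmon f).

Definition weak_groebner_repr (f : nonzero ore_mod) : Prop :=
  represented ore_act g (fun t => mle t (lterm f)) f.

Definition syz_eval (s : syz_mod) : ore_mod :=
  \sum_l tens_lift (fun v w => ore_act v (g l) w) (s l).

Definition gr_syz_eval (s : syz_mod) : ore_mod :=
  \sum_l tens_lift (fun v w => gr_act v (lmon (g l)) w) (s l).

Lemma syz_deg_exists (s : nonzero syz_mod) :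
  exists t, is_max lt (fun t => exists2 k, syz_comp k s != 0 & t = tdeg k) t.
Proof.
have [K HK] := syz_comp_supp s.
apply: (is_max_exists (s := map tdeg K)); first exact: mo_wo.
  by have [k hk] := syz_comp_neq0 (nz_neq0 s); exists (tdeg k); exists k.
by move=> _ [k hk ->]; apply: map_f; exact: HK.
Qed.

Definition syz_deg (s : nonzero syz_mod) : mterm n m :=
  sval (cid (syz_deg_exists s)).

Definition leading_form (s : nonzero syz_mod) : syz_mod :=
  \sum_(k \in [set k | tdeg k = syz_deg s]) syz_comp k s.

Definition homogeneous (s : nonzero syz_mod) : Prop :=
  nz_val s = leading_form s.

Definition gebauer_moeller (GM : set (nonzero syz_mod)) : Prop :=
  (forall s, GM s -> homogeneous s) /\
  bispan syz_gr_act [set nz_val s | s in GM] = [set s | gr_syz_eval s = 0].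

Definition has_lifting (s : nonzero syz_mod) : Prop :=
  exists U : nonzero syz_mod, syz_eval U = 0 /\ leading_form U = s.

Definition quasi_groebner_repr (s : nonzero syz_mod) : Prop :=
  represented ore_act g (fun t => lt t (syz_deg s)) (syz_eval s).

End Family.
End Order.
End Groebner.

(* Main.v *)
Require Import Defs.
From HB Require Import structures.
From mathcomp Require Import all_boot all_order all_algebra.
From mathcomp Require Import finmap.
From mathcomp Require Import monalg.
From mathcomp Require Import boolp classical_sets functions cardinality fsbigop.

(* Since Y_i r = alpha_i(r) Y_i + delta_i(r), the products of the Ore extension
   and of its associated graded ring differ by terms of lower degree.  Hence, if
   every component of a syzygy s has degree <= d, then syz_eval s and
   gr_syz_eval s agree up to terms < d, and so do the two bimodule actions on syzygies.
   (1) => (2) subtracts a representation of M(f) from f, by well-founded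
   induction on T(f).  (2) => (3) holds because gr_syz_eval s = 0 forces
   T(syz_eval s) < v(s).  (3) => (4) takes U to be s minus the quasi-Groebner
   representation.  (4) => (5) writes s through the generators, keeps the summands
   of degree v(s), and replaces each generator by its lifting.  (5) => (1): among
   the s with syz_eval s = f, a leading form of degree > T(f) lies in
   ker gr_syz_eval, so subtracting a lifting of it lowers the degree; once the
   degree is T(f), the leading form represents M(f). *)

(** * Term orders: positivity, and induction on terms *)

Section TermOrder.
Set Implicit Arguments.
Unset Strict Implicit.
Import GRing.Theory.
Local Open Scope ring_scope.
Variables (n m : nat) (prec : term_order n) (lt : mterm_order m prec).
Implicit Types (t w : term n) (i : 'I_n) (x y z : mterm n m).

Lemma prec_trans : transitive prec. Proof. by case: (to_wo prec). Qed.

Lemma mo_trans : transitive lt. Proof. by case: (mo_wo lt). Qed.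

Lemma mo_irr : irreflexive lt. Proof. by case: (mo_wo lt). Qed.

Lemma mle_refl x : mle lt x x. Proof. by rewrite /mle eqxx. Qed.

Lemma mle_mo_trans x y z : mle lt x y -> lt y z -> lt x z.
Proof. by case/orP=> [/eqP->|]//; exact: mo_trans. Qed.

Lemma mo_mle_trans x y z : lt x y -> mle lt y z -> lt x z.
Proof. by move=> xy /orP[/eqP<-|]//; exact: mo_trans. Qed.

Lemma mle_anti x y : mle lt x y -> mle lt y x -> x = y.
Proof.
move=> xy /orP[/eqP//|yx]; case/orP: xy => [/eqP//|xy].
by have := mo_trans xy yx; rewrite mo_irr.
Qed.

(** If [t] preceded [0], then [t + t] would precede [t] and hence [0] as well, and doubling would go
    on to give an infinite descent. *)
Lemma prec_gt0 t : t != 0 -> prec 0 t.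
Proof.
case: (to_wo prec) => _ tr tot wf /tot /orP[t0|//]; exfalso.
elim/(well_founded_ind wf): t t0 => t IH t0.
have tt : prec (t + t) t by rewrite -[X in prec _ X]addr0 to_mul.
exact: IH tt (tr _ _ _ tt t0).
Qed.

Lemma prec_yexp i t : prec t (t + yexp i).
Proof.
rewrite -{1}[t]addr0 to_mul // prec_gt0 //; apply/eqP.
move=> /(congr1 (fun s : term n => s i)).
by rewrite yexpE term0E eqxx.
Qed.

(** Induction on the total exponent, one variable at a time, to match [ore_lmulYT]. *)
Lemma term_ind (P : term n -> Prop) :
  P 0 -> (forall t i, P t -> P (t + yexp i)) -> forall t, P t.
Proof.
move=> P0 PS t; have [k] := ubnP (\sum_i t i)%N; elim: k t => // k IH t.
have [/existsP[i ti]|/existsPn t0] := boolP [exists i, t i != 0%N]; last first.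
  move=> _; suff -> : t = 0 by []; apply: eq_term => i.
  by rewrite term0E; have /negPn/eqP := t0 i.
(* Since [t i] is nonzero, the truncated subtraction loses nothing. *)
pose t' : term n := [ffun j => t j - yexp i j]%N.
have -> : t = t' + yexp i.
  apply: eq_term => j; rewrite termDE ffunE subnK // yexpE.
  by case: eqP => // ->; rewrite lt0n.
rewrite ltnS => lk; apply/PS/IH; apply: leq_trans lk.
rewrite (bigD1 i) //= [X in (_ < X)%N](bigD1 i) //= -addSn leq_add //.
  by rewrite termDE yexpE eqxx addn1.
by apply: leq_sum => j _; rewrite termDE leq_addr.
Qed.

End TermOrder.

(** * Supports of products in the Ore extension and in its graded ring *)

Section OreSupport.
Set Implicit Arguments.
Unset Strict Implicit.
Import GRing.Theory.
Local Open Scope ring_scope.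
Variables (R : nzRingType) (n : nat) (prec : term_order n).
Implicit Types (D : ore_data R n) (t w p q : term n).

Definition prle w t : bool := (w == t) || prec w t.

Lemma prle_refl t : prle t t. Proof. by rewrite /prle eqxx. Qed.

Lemma prle_prec_trans p q t : prle p q -> prec q t -> prec p t.
Proof. by case/orP=> [/eqP->|]//; exact: prec_trans. Qed.

Lemma prle_trans p q t : prle p q -> prle q t -> prle p t.
Proof. by move=> pq /orP[/eqP<-|qt]//; rewrite /prle (prle_prec_trans pq qt) orbT. Qed.

Lemma prle_add w p q : prle p q -> prle (w + p) (w + q).
Proof. by case/orP=> [/eqP->|h]; rewrite /prle ?eqxx // to_mul ?orbT. Qed.

Lemma prle_yexp i t : prle t (t + yexp i).
Proof. by rewrite /prle prec_yexp orbT. Qed.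

Lemma sum_neq0 (V : nmodType) (I : eqType) (r : seq I) (F : I -> V) :
  \sum_(i <- r) F i != 0 -> exists2 i, i \in r & F i != 0.
Proof.
move=> s0; apply: contrapT => no; case/eqP: s0; rewrite big_seq big1 // => i ir.
by apply: contrapT => /eqP h; apply: no; exists i.
Qed.

Lemma opprDACA (V : zmodType) (x y z t : V) : x + y - (z + t) = (x - z) + (y - t).
Proof. by rewrite opprD addrACA. Qed.

Lemma add_neq0 (V : nmodType) (x y : V) : x + y != 0 -> x != 0 \/ y != 0.
Proof. by have [->|] := eqVneq x 0; [rewrite add0r; right|left]. Qed.

Lemma mcoeffU_neq0 (a : R) t w : (<< a *g t >> : {malg R[term n]})@_w != 0 ->
  w = t /\ a != 0.
Proof. by rewrite mcoeffU; have [->|] := eqVneq t w; rewrite ?mulr0n ?eqxx. Qed.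

Lemma ore_lmulY_supp D i (f : ore D) w : (ore_lmulY i f)@_w != 0 ->
  exists2 t, f@_t != 0 & w = t \/ w = t + yexp i.
Proof.
rewrite /ore_lmulY raddf_sum => /sum_neq0[t]; rewrite -mcoeff_neq0 => ft.
rewrite /= mcoeffD => /add_neq0[]/mcoeffU_neq0[-> _]; exists t => //; by [right|left].
Qed.

(** Each factor [Y_i] either raises the exponent by [yexp i], through [alpha], or keeps it, through
    [delta]; so no term passes [t + q]. *)
Lemma ore_lmulT_supp D t (f : ore D) w : (ore_lmulT t f)@_w != 0 ->
  exists2 q, f@_q != 0 & prle w (t + q).
Proof.
elim/term_ind: t w => [|t i IH] w.
  by rewrite ore_lmulT0; exists w; rewrite ?add0r ?prle_refl.
rewrite -ore_lmulYT => /ore_lmulY_supp[w' /IH[q fq le] wE]; exists q => //.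
rewrite addrAC; case: wE => ->; first exact: prle_trans le (prle_yexp _ _).
by rewrite ![_ + yexp i]addrC prle_add.
Qed.

(** The two multiplications differ only by the [delta] part of each [Y_i], which does not raise the
    exponent and so falls strictly below [t + q]. *)
Lemma ore_lmulT_gr_supp D t (f : ore D) w :
  (ore_lmulT t f - ore_lmulT (D := graded D) t f : ore D)@_w != 0 ->
  exists2 q, f@_q != 0 & prec w (t + q).
Proof.
elim/term_ind: t w => [|t i IH] w.
  by rewrite !ore_lmulT0 subrr mcoeff0 eqxx.
pose h : ore D := ore_lmulT (D := graded D) t f.
rewrite -(@ore_lmulYT _ _ D) -(@ore_lmulYT _ _ (graded D)) -/h.
(* The error after one more [Y_i] is the old error multiplied by [Y_i], plus the new error of [Y_i]
   on the graded product [h]. *)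
have -> : ore_lmulY i (ore_lmulT t f) - ore_lmulY (D := graded D) i h =
    ore_lmulY i (ore_lmulT t f - h) +
    (ore_lmulY i h - ore_lmulY (D := graded D) i h) :> ore D.
  by rewrite raddfB /= addrA subrK.
rewrite mcoeffD => /add_neq0[].
  move=> /ore_lmulY_supp[w' /IH[q fq lw] wE]; exists q => //; rewrite addrAC.
  case: wE => ->; first exact: prec_trans lw (prec_yexp _ _ _).
  by rewrite ![_ + yexp i]addrC to_mul.
rewrite /ore_lmulY /= -sumrB raddf_sum => /sum_neq0[w'].
rewrite -mcoeff_neq0 => hw.
(* The [alpha] parts cancel, and only the [delta] part at [w'] remains. *)
rewrite /= monalgU0 addr0 addrC addKr => /mcoeffU_neq0[-> _].
have [q fq le] := @ore_lmulT_supp (graded D) t f w' hw; exists q => //.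
by rewrite addrAC; exact: prle_prec_trans le (prec_yexp _ _ _).
Qed.

Lemma ore_mul_supp D (f h : ore D) w : (f * h)@_w != 0 ->
  exists p q, [/\ f@_p != 0, h@_q != 0 & prle w (p + q)].
Proof.
rewrite oreE ore_mulE raddf_sum => /sum_neq0[p]; rewrite -mcoeff_neq0 => fp.
rewrite /= mcoeffZ; have [->|] := eqVneq (ore_lmulT p h)@_w 0.
  by rewrite mulr0 eqxx.
by move=> /ore_lmulT_supp[q hq le] _; exists p, q.
Qed.

Lemma ore_mul_gr_supp D (f h : ore D) w : (f * h - gr_mul f h)@_w != 0 ->
  exists p q, [/\ f@_p != 0, h@_q != 0 & prec w (p + q)].
Proof.
rewrite /gr_mul !oreE !ore_mulE -sumrB raddf_sum /= => /sum_neq0[p].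
rewrite -mcoeff_neq0 => fp; rewrite -scalerBr /= mcoeffZ.
have [->|] := eqVneq (ore_lmulT p h - ore_lmulT (D := graded D) p h : ore D)@_w 0.
  by rewrite mulr0 eqxx.
by move=> /ore_lmulT_gr_supp[q hq le] _; exists p, q.
Qed.

(** An equality of exponents this time, because a graded product of two monomials is again a single
    monomial. *)
Lemma gr_mul_supp D (f h : ore D) w : (gr_mul f h)@_w != 0 ->
  exists p q, [/\ f@_p != 0, h@_q != 0 & w = p + q].
Proof.
rewrite {1}[f]monalgE {1}[h]monalgE /gr_mul.
rewrite (@mulr_suml (ore (graded D))) raddf_sum /= => /sum_neq0[p].
rewrite -mcoeff_neq0 (@mulr_sumr (ore (graded D))) raddf_sum /= => fp /sum_neq0[q].
rewrite -mcoeff_neq0 => hq; rewrite graded_mulUU => /mcoeffU_neq0[-> _].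
by exists p, q.
Qed.

End OreSupport.

(** * The syzygy bimodule as the direct sum of its components *)

Section Syzygies.
Set Implicit Arguments.
Unset Strict Implicit.
Import GRing.Theory.
Local Open Scope ring_scope.
Variables (R : nzRingType) (n : nat) (D : ore_data R n) (u : nat).
Local Notation tens_ore := (tensor (hatR D) (ore D) (ore D)).
Local Notation key := (term n * 'I_u * term n)%type.
Implicit Types (s : syz_mod D u) (v w x y : ore D) (k : key) (l : 'I_u).

Definition syz_tens l v w : syz_mod D u :=
  [ffun j => if j == l then tens (hatR D) v w else 0].

Lemma syz_tensDl l v v' w : syz_tens l (v + v') w = syz_tens l v w + syz_tens l v' w.
Proof. by apply/ffunP => j; rewrite !ffunE; case: eqP; rewrite ?tensDl ?addr0. Qed.

Lemma syz_tensDr l v w w' : syz_tens l v (w + w') = syz_tens l v w + syz_tens l v w'.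
Proof. by apply/ffunP => j; rewrite !ffunE; case: eqP; rewrite ?tensDr ?addr0. Qed.

Lemma syz_tens0l l w : syz_tens l 0 w = 0.
Proof. by apply/ffunP => j; rewrite !ffunE tens0l if_same. Qed.

Lemma syz_tens0r l v : syz_tens l v 0 = 0.
Proof. by apply/ffunP => j; rewrite !ffunE tens0r if_same. Qed.

(** A syzygy is the sum of its coordinates, and each of these is a sum of pure tensors. *)
Lemma syz_ind (Q : syz_mod D u -> Prop) :
  Q 0 -> (forall s t, Q s -> Q t -> Q (s + t)) ->
  (forall l v w, Q (syz_tens l v w)) -> forall s, Q s.
Proof.
move=> Q0 QD QT s.
have -> : s = \sum_l ([ffun j => if j == l then s l else 0] : syz_mod D u).
  apply/ffunP => j; rewrite sum_ffunE (bigD1 j) //= big1 => [|l /negPf lj].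
    by rewrite ffunE eqxx addr0.
  by rewrite ffunE eq_sym lj.
apply: (big_ind Q) => // l _; elim/tens_ind: (s l) => [|t1 t2 Q1 Q2|v w].
- by rewrite (_ : [ffun _ => _] = 0) //; apply/ffunP => j; rewrite !ffunE if_same.
- rewrite (_ : [ffun _ => _] = [ffun j => if j == l then t1 else 0] +
      [ffun j => if j == l then t2 else 0] :> syz_mod D u); first exact: QD.
  by apply/ffunP => j; rewrite !ffunE; case: eqP; rewrite ?addr0.
exact: QT.
Qed.

Lemma tens_comp_is_additive lam rho : additive (@tens_comp R n D lam rho).
Proof.
move=> s t; apply: (@addIr _ (tens_comp lam rho t)).
by rewrite subrK -[LHS](tens_liftD (tens_comp_balanced D lam rho)) subrK.
Qed.

HB.instance Definition _ lam rho :=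
  GRing.isZmodMorphism.Build tens_ore tens_ore (@tens_comp R n D lam rho)
    (tens_comp_is_additive lam rho).

Lemma syz_comp_is_additive k : additive (@syz_comp R n D u k).
Proof.
case: k => [[lam l] rho] s t; apply/ffunP => j; rewrite !ffunE.
by case: eqP; rewrite ?subr0 // raddfB.
Qed.

HB.instance Definition _ k :=
  GRing.isZmodMorphism.Build (syz_mod D u) (syz_mod D u) (@syz_comp R n D u k)
    (syz_comp_is_additive k).

Lemma tens_compE lam rho v w : tens_comp lam rho (tens (hatR D) v w) =
  tens (hatR D) (<< v@_lam *g lam >> : ore D) (<< w@_rho *g rho >> : ore D).
Proof. exact: (tens_liftE (tens_comp_balanced D lam rho)). Qed.

Lemma syz_comp_tens k l v w : syz_comp k (syz_tens l v w) =
  if k.1.2 == l then syz_tens l << v@_k.1.1 *g k.1.1 >> << w@_k.2 *g k.2 >> else 0.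
Proof.
case: k => [[lam l'] rho] /=; apply/ffunP => j; rewrite ffunE.
have [->|jl] := eqVneq j l'.
  by rewrite ffunE; case: eqVneq => [->|nl]; rewrite ?raddf0 ffunE ?eqxx // tens_compE.
by case: eqVneq => [<-|_]; rewrite ffunE // (negPf jl).
Qed.

(** The components are given by orthogonal idempotent projections, which makes their sum direct. *)
Lemma syz_compK k k' s :
  syz_comp k (syz_comp k' s) = if k == k' then syz_comp k s else 0.
Proof.
elim/syz_ind: s => [|s t|l v w]; first by rewrite !raddf0 if_same.
  by rewrite !raddfD /= => -> ->; case: eqP; rewrite ?addr0.
rewrite !syz_comp_tens; case: (eqVneq k'.1.2 l) => [lk'|nl]; last first.
  by rewrite raddf0; case: eqVneq => // ->; rewrite (negPf nl).
rewrite syz_comp_tens.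
have [->|nk] := eqVneq k k'; first by rewrite lk' eqxx !mcoeffUU.
have [lk|//] := eqVneq k.1.2 l; rewrite !mcoeffU.
have [e1|_] := eqVneq k'.1.1 k.1.1; last by rewrite mulr0n monalgU0 syz_tens0l.
have [e2|_] := eqVneq k'.2 k.2; last by rewrite mulr0n monalgU0 syz_tens0r.
case/negP: nk; case: k k' lk lk' e1 e2 => [[? ?] ?] [[? ?] ?] /= -> -> -> ->.
by rewrite eqxx.
Qed.

Lemma syz_eqP s t : (forall k, syz_comp k s = syz_comp k t) -> s = t.
Proof.
move=> E; apply/eqP; rewrite -subr_eq0; apply: contrapT => /negP/syz_comp_neq0[k].
by rewrite raddfB /= E subrr eqxx.
Qed.

Lemma syz_sum_comp s : exists K : seq key, s = \sum_(k <- K) syz_comp k s.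
Proof.
(* [undup] prevents a component from being counted twice. *)
have [K HK] := syz_comp_supp s; exists (undup K); apply: syz_eqP => k.
rewrite raddf_sum /= (eq_bigr (fun k' => if k' == k then syz_comp k s else 0)).
  have [kK|kK] := boolP (k \in K); last first.
    have k0 : syz_comp k s = 0 by apply: contrapT => /eqP/HK; exact/negP.
    by rewrite big1 // => k' _; rewrite k0 if_same.
  rewrite (bigD1_seq k) ?mem_undup ?undup_uniq //= eqxx big1 ?addr0 //.
  by move=> k' /negPf ->.
by move=> k' _; rewrite syz_compK eq_sym; case: eqP => // ->.
Qed.

Definition bt_key (p : bterm R n u) : key := (bt_lam p, bt_l p, bt_rho p).

Definition bt_syz (p : bterm R n u) : syz_mod D u :=
  syz_tens (bt_l p) << bt_a p *g bt_lam p >> << bt_b p *g bt_rho p >>.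

(** The induction behind all degree estimates below: it suffices to treat single terms whose key
    satisfies [P], so a bound on the degrees of [s] is inherited by every term considered. *)
Lemma syz_supp_ind (P : key -> Prop) (Q : syz_mod D u -> Prop) :
  Q 0 -> (forall s t, Q s -> Q t -> Q (s + t)) ->
  (forall p, P (bt_key p) -> Q (bt_syz p)) ->
  forall s, (forall k, syz_comp k s != 0 -> P k) -> Q s.
Proof.
move=> Q0 QD QT s Ps; have [K ->] := syz_sum_comp s.
apply: (big_ind Q) => // k _; have [->//|/Ps Pk] := eqVneq (syz_comp k s) 0.
(* Once [P k] is known, [s] may be split into arbitrary pure tensors, even with keys outside [P]:
   the projection to the key [k] turns each of them into [0] or a single term of key [k]. *)
elim/syz_ind: s {Ps} => [|s t|l v w]; first by rewrite raddf0.
  by rewrite raddfD; exact: QD.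
rewrite syz_comp_tens; case: eqVneq => // lk.
have [->|v0] := eqVneq v@_k.1.1 0; first by rewrite monalgU0 syz_tens0l.
have [->|w0] := eqVneq w@_k.2 0; first by rewrite monalgU0 syz_tens0r.
apply: (QT (BTerm k.1.1 l k.2 v0 w0)).
by rewrite /bt_key /= -lk -!surjective_pairing.
Qed.

End Syzygies.

(** * Degrees of module elements and syzygies, and the two evaluations *)

Section Degrees.
Set Implicit Arguments.
Unset Strict Implicit.
Import GRing.Theory.
Local Open Scope ring_scope.
Variables (R : nzRingType) (n : nat) (D : ore_data R n) (m u : nat).
Variables (prec : term_order n) (lt : mterm_order m prec).
Variable g : 'I_u -> nonzero (ore_mod D m).
Local Notation key := (term n * 'I_u * term n)%type.
Implicit Types (s : syz_mod D u) (v w x y : ore D) (k : key) (l : 'I_u).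
Implicit Types (f h : ore_mod D m) (d t : mterm n m) (p q r : term n).

(** Two-sided multiplication of a module term; [tdeg lt g (p, l, q)] is by conversion
    [shift p q (lterm lt (g l))]. *)
Definition shift p q d : mterm n m := (p + d.1 + q, d.2).

Lemma shift_lt p q d d' : lt d d' -> lt (shift p q d) (shift p q d').
Proof.
(* Terms commute, so a two-sided multiple is a left multiple, the only kind that the axioms of the
   order mention. *)
have E e : shift p q e = mtmul (p + q) e by rewrite /shift /mtmul addrAC.
by move=> dd'; rewrite !E mo_mulr.
Qed.

Lemma prec_lt p q i : prec p q -> lt (p, i) (q, i).
Proof.
by move=> /(mo_mull lt (0, i)); rewrite /mtmul /= !addr0.
Qed.

Lemma prle_mle p q i : prle prec p q -> mle lt (p, i) (q, i).
Proof. by case/orP=> [/eqP->|/prec_lt h]; rewrite /mle ?eqxx ?h ?orbT. Qed.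

Lemma shift_prec_l p p' q d : prec p p' -> lt (shift p q d) (shift p' q d).
Proof. by move=> pp'; apply: prec_lt; rewrite -!addrA ![_ + (_ + _)]addrC to_mul. Qed.

Lemma shift_prec_r p q q' d : prec q q' -> lt (shift p q d) (shift p q' d).
Proof. by move=> qq'; apply: prec_lt; rewrite to_mul. Qed.

Lemma shift_prle p p' q q' d :
  prle prec p p' -> prle prec q q' -> mle lt (shift p q d) (shift p' q' d).
Proof.
move=> pp' qq'; apply: prle_mle; apply: (@prle_trans _ _ _ (p + d.1 + q')).
  exact: prle_add.
by rewrite -!addrA ![_ + (_ + _)]addrC prle_add.
Qed.

Lemma shiftA p q p' q' d : shift p q (shift p' q' d) = shift (p + p') (q' + q) d.
Proof. by rewrite /shift /= !addrA. Qed.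

(** Bounds are put on supports rather than on leading terms: such bounds pass to sums and make sense
    at [0], where [lterm] and [syz_deg] are not defined. *)
Definition mod_supp (P : mterm n m -> Prop) f := forall t, mcoef f t != 0 -> P t.

Definition syz_supp (P : mterm n m -> Prop) s :=
  forall k, syz_comp k s != 0 -> P (tdeg lt g k).

Lemma mcoefD f h t : mcoef (f + h) t = mcoef f t + mcoef h t.
Proof. by rewrite /mcoef ffunE mcoeffD. Qed.

Lemma mcoefN f t : mcoef (- f) t = - mcoef f t.
Proof. by rewrite /mcoef ffunE mcoeffN. Qed.

Lemma mcoef0 t : mcoef (0 : ore_mod D m) t = 0.
Proof. by rewrite /mcoef ffunE mcoeff0. Qed.

Lemma mod_supp0 P : mod_supp P 0.
Proof. by move=> t; rewrite mcoef0 eqxx. Qed.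

Lemma mod_suppD P f h : mod_supp P f -> mod_supp P h -> mod_supp P (f + h).
Proof. by move=> Pf Ph t; rewrite mcoefD => /add_neq0[/Pf|/Ph]. Qed.

Lemma mod_suppN P f : mod_supp P f -> mod_supp P (- f).
Proof. by move=> Pf t; rewrite mcoefN oppr_eq0 => /Pf. Qed.

Lemma mod_suppB P f h : mod_supp P f -> mod_supp P h -> mod_supp P (f - h).
Proof. by move=> Pf /mod_suppN; exact: mod_suppD. Qed.

Lemma sub_mod_supp (P Q : mterm n m -> Prop) f :
  (forall t, P t -> Q t) -> mod_supp P f -> mod_supp Q f.
Proof. by move=> PQ Pf t /Pf/PQ. Qed.

Lemma syz_suppD P s s' : syz_supp P s -> syz_supp P s' -> syz_supp P (s + s').
Proof. by move=> Ps Pt k; rewrite raddfD => /add_neq0[/Ps|/Pt]. Qed.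

Lemma syz_suppN P s : syz_supp P s -> syz_supp P (- s).
Proof. by move=> Ps k; rewrite raddfN /= oppr_eq0 => /Ps. Qed.

Lemma syz_suppB P s s' : syz_supp P s -> syz_supp P s' -> syz_supp P (s - s').
Proof. by move=> Ps /syz_suppN; exact: syz_suppD. Qed.

Lemma syz_supp0 P : syz_supp P 0.
Proof. by move=> k; rewrite raddf0 eqxx. Qed.

Lemma sub_syz_supp (P Q : mterm n m -> Prop) s :
  (forall t, P t -> Q t) -> syz_supp P s -> syz_supp Q s.
Proof. by move=> PQ Ps k /Ps/PQ. Qed.

Lemma syz_tens_supp k l v w :
  syz_comp k (syz_tens l v w) != 0 -> [/\ k.1.2 = l, v@_k.1.1 != 0 & w@_k.2 != 0].
Proof.
rewrite syz_comp_tens; have [->|_] := eqVneq k.1.2 l; last by rewrite eqxx.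
have [->|v0] := eqVneq v@_k.1.1 0; first by rewrite monalgU0 syz_tens0l eqxx.
by have [->|w0] := eqVneq w@_k.2 0; first by rewrite monalgU0 syz_tens0r eqxx.
Qed.

Lemma syz_supp_tens P l v w :
  (forall p q, v@_p != 0 -> w@_q != 0 -> P (shift p q (lterm lt (g l)))) ->
  syz_supp P (syz_tens l v w).
Proof. by move=> H [[p l'] q] /syz_tens_supp[/= -> vp wq]; exact: H. Qed.

Section Represented.
Variables (act : ore D -> ore_mod D m -> ore D -> ore_mod D m).
Variables (b : 'I_u -> ore_mod D m) (E : {additive syz_mod D u -> ore_mod D m}).
Hypothesis E_tens : forall l v w, E (syz_tens l v w) = act v (b l) w.

(** A representation is the value of the evaluation [E] at a syzygy. With [E] either [syz_eval] or
    [gr_syz_eval], this covers all three notions of representation. *)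
Lemma representedP P f :
  represented lt g act b P f <-> exists2 s, syz_supp P s & E s = f.
Proof.
split=> [[N [p [Pp ->]]]|[s Ps <-]].
  exists (\sum_(i < N) bt_syz D (p i)).
    apply: (big_ind (syz_supp P)) => [|s t|i _]; [exact: syz_supp0|exact: syz_suppD|].
    apply: syz_supp_tens => q r /mcoeffU_neq0[-> _] /mcoeffU_neq0[-> _]; exact: Pp.
  by rewrite raddf_sum; apply: eq_bigr => i _; exact: E_tens.
move: s Ps; apply: syz_supp_ind => [|s t|p Pp].
- have p0 : 'I_0 -> bterm R n u by case.
  by rewrite raddf0; exists 0%N, p0; rewrite big_ord0; split=> // -[].
- case=> [N1 [p1 [P1 E1]]] [N2 [p2 [P2 E2]]].
  exists (N1 + N2)%N, (fun i =>
    match fintype.split i with inl j => p1 j | inr j => p2 j end).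
  split=> [i|]; first by case: (fintype.split i).
  rewrite raddfD /= E1 E2 big_split_ord; congr (_ + _); apply: eq_bigr => i _.
    by rewrite (unsplitK (inl _ i)).
  by rewrite (unsplitK (inr _ i)).
by exists 1%N, (fun=> p); rewrite big_ord1 -E_tens.
Qed.

End Represented.

Lemma syz_eval_is_additive : additive (syz_eval g).
Proof.
move=> s t; apply: (@addIr _ (syz_eval g t)).
rewrite subrK /syz_eval -big_split; apply: eq_bigr => l _ /=.
by rewrite -(tens_liftD (ore_act_balanced (g l))) !ffunE subrK.
Qed.

HB.instance Definition _ :=
  GRing.isZmodMorphism.Build (syz_mod D u) (ore_mod D m) (syz_eval g)
    syz_eval_is_additive.

Lemma gr_syz_eval_is_additive : additive (gr_syz_eval lt g).
Proof.
move=> s t; apply: (@addIr _ (gr_syz_eval lt g t)).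
rewrite subrK /gr_syz_eval -big_split; apply: eq_bigr => l _ /=.
by rewrite -(tens_liftD (gr_act_balanced (lmon lt (g l)))) !ffunE subrK.
Qed.

HB.instance Definition _ :=
  GRing.isZmodMorphism.Build (syz_mod D u) (ore_mod D m) (gr_syz_eval lt g)
    gr_syz_eval_is_additive.

Lemma syz_eval_tens l v w : syz_eval g (syz_tens l v w) = ore_act v (g l) w.
Proof.
rewrite /syz_eval (bigD1 l) //= big1 => [|j /negPf jl]; rewrite ffunE ?eqxx ?jl.
  by rewrite addr0 (tens_liftE (ore_act_balanced (g l))).
exact: (tens_lift0 (ore_act_balanced (g j))).
Qed.

Lemma gr_syz_eval_tens l v w :
  gr_syz_eval lt g (syz_tens l v w) = gr_act v (lmon lt (g l)) w.
Proof.
rewrite /gr_syz_eval (bigD1 l) //= big1 => [|j /negPf jl]; rewrite ffunE ?eqxx ?jl.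
  by rewrite addr0 (tens_liftE (gr_act_balanced (lmon lt (g l)))).
exact: (tens_lift0 (gr_act_balanced (lmon lt (g j)))).
Qed.

Lemma lterm_neq0 (f : nonzero (ore_mod D m)) : mcoef f (lterm lt f) != 0.
Proof. by rewrite /lterm; case: cid => t []. Qed.

Lemma lterm_max (f : nonzero (ore_mod D m)) :
  mod_supp (fun t => mle lt t (lterm lt f)) f.
Proof. by rewrite /lterm; case: cid => t []. Qed.

Lemma lmonE (f : nonzero (ore_mod D m)) t :
  mcoef (lmon lt f) t = if t == lterm lt f then lcoef lt f else 0.
Proof.
rewrite /mcoef ffunE; case: t (lterm lt f) => [p i] [q j] /=; rewrite xpair_eqE.
have [_|_] := eqVneq i j; last by rewrite mcoeff0 andbF.
by rewrite mcoeffU andbT eq_sym; case: eqP.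
Qed.

Lemma lmon_supp (f : nonzero (ore_mod D m)) :
  mod_supp (fun t => t = lterm lt f) (lmon lt f).
Proof.
by move=> t; rewrite lmonE; have [->|] := eqVneq t (lterm lt f); rewrite ?eqxx.
Qed.

Lemma lmon_lt (f : nonzero (ore_mod D m)) :
  mod_supp (fun t => lt t (lterm lt f)) (nz_val f - lmon lt f).
Proof.
move=> t; rewrite mcoefD mcoefN lmonE.
have [->|ne] := eqVneq t (lterm lt f); first by rewrite -/(lcoef lt f) subrr eqxx.
by rewrite subr0 => /lterm_max/orP[/eqP E|//]; rewrite E eqxx in ne.
Qed.

Lemma gr_act_supp v f w t : mcoef (gr_act v f w) t != 0 ->
  exists p q d, [/\ v@_p != 0, w@_q != 0, mcoef f d != 0 & t = shift p q d].
Proof.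
case: t => t i; rewrite /mcoef ffunE /= => /gr_mul_supp[p' [q [/gr_mul_supp]]].
by case=> p [r [vp fr ->]] wq ->; exists p, q, (r, i).
Qed.

Lemma ore_act_supp v f w t : mcoef (ore_act v f w) t != 0 ->
  exists p q d, [/\ v@_p != 0, w@_q != 0, mcoef f d != 0 & mle lt t (shift p q d)].
Proof.
case: t => t i; rewrite /mcoef ffunE /=.
move=> /(ore_mul_supp prec)[p' [q [/(ore_mul_supp prec)]]].
case=> p [r [vp fr le1]] wq le2; exists p, q, (r, i); split=> //.
apply: prle_mle; apply: prle_trans le2 _.
by rewrite ![_ + q]addrC prle_add.
Qed.

Lemma ore_act_gr_act_supp v f w t :
  mcoef (ore_act v f w - gr_act v f w) t != 0 ->
  exists p q d, [/\ v@_p != 0, w@_q != 0, mcoef f d != 0 & lt t (shift p q d)].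
Proof.
case: t => t i; rewrite /mcoef !ffunE /=.
(* The two products are replaced by graded ones in turn, each at the cost of strictly lower
   terms. *)
have -> : v * f i * w - gr_mul (gr_mul v (f i)) w = (v * f i - gr_mul v (f i)) * w +
    (gr_mul v (f i) * w - gr_mul (gr_mul v (f i)) w) by rewrite mulrBl addrA subrK.
rewrite mcoeffD => /add_neq0[].
  move=> /(ore_mul_supp prec)[p' [q [/(ore_mul_gr_supp prec)]]].
  case=> p [r [vp fr lp]] wq le2; exists p, q, (r, i); split=> //.
  apply: prec_lt; apply: prle_prec_trans le2 _.
  by rewrite ![_ + q]addrC to_mul.
move=> /(ore_mul_gr_supp prec)[p' [q [/gr_mul_supp]]].
case=> p [r [vp fr ->]] wq lq; exists p, q, (r, i); split=> //.
exact: prec_lt.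
Qed.

(** On a single term, lower terms arise in two ways: from replacing a generator by its leading
    monomial, and from replacing the Ore product by the graded one. *)
Lemma syz_eval_diff_lt s d : syz_supp (fun t => mle lt t d) s ->
  mod_supp (fun t => lt t d) (syz_eval g s - gr_syz_eval lt g s).
Proof.
move: s; apply: syz_supp_ind => [|s t|b Pb].
- by rewrite !raddf0 addr0; exact: mod_supp0.
- by rewrite !raddfD /= addrACA; exact: mod_suppD.
rewrite syz_eval_tens gr_syz_eval_tens; set v : ore D := << _ *g _ >>.
set w : ore D := << _ *g _ >>; set f := g _.
have -> : ore_act v f w - gr_act v (lmon lt f) w = ore_act v (nz_val f - lmon lt f) w +
    (ore_act v (lmon lt f) w - gr_act v (lmon lt f) w).
  by apply/ffunP => i; rewrite !ffunE mulrBr mulrBl addrA subrK.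
apply: mod_suppD => t.
  move=> /ore_act_supp[p [q [e [/mcoeffU_neq0[-> _] /mcoeffU_neq0[-> _]]]]].
  move=> /lmon_lt le1 le2; apply: mo_mle_trans Pb.
  exact: mle_mo_trans le2 (shift_lt _ _ le1).
move=> /ore_act_gr_act_supp[p [q [e [/mcoeffU_neq0[-> _] /mcoeffU_neq0[-> _]]]]].
by move=> /lmon_supp -> lt1; exact: mo_mle_trans lt1 Pb.
Qed.

(** Degrees are preserved exactly, since [lmon] has a single term and graded products add
    exponents. *)
Lemma gr_syz_eval_supp P s : syz_supp P s -> mod_supp P (gr_syz_eval lt g s).
Proof.
move: s; apply: syz_supp_ind => [|s t|b Pb].
- by rewrite raddf0; exact: mod_supp0.
- by rewrite raddfD; exact: mod_suppD.
rewrite gr_syz_eval_tens => t /gr_act_supp[p [q [d]]].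
by case=> /mcoeffU_neq0[-> _] /mcoeffU_neq0[-> _] /lmon_supp -> ->.
Qed.

Lemma syz_eval_le s d : syz_supp (fun t => mle lt t d) s ->
  mod_supp (fun t => mle lt t d) (syz_eval g s).
Proof.
move=> sd; rewrite -[syz_eval g s](subrK (gr_syz_eval lt g s)); apply: mod_suppD.
  apply: sub_mod_supp (syz_eval_diff_lt sd) => t; rewrite /mle => ->; exact: orbT.
exact: gr_syz_eval_supp.
Qed.

End Degrees.

(** * The two bimodule actions on syzygies *)

Section Actions.
Set Implicit Arguments.
Unset Strict Implicit.
Import GRing.Theory.
Local Open Scope ring_scope.
Variables (R : nzRingType) (n : nat) (D : ore_data R n) (u : nat).
Implicit Types (s : syz_mod D u) (v w x y : ore D) (l : 'I_u).

(** The counterpart of [syz_gr_act] for the Ore product. Liftings are multiplied by this action,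
    because it is the one with which [syz_eval] is compatible. *)
Definition syz_act x s y : syz_mod D u :=
  [ffun l => tens_lift (fun v w => tens (hatR D) (x * v) (w * y)) (s l)].

Lemma syz_act_balanced x y : @balanced R (hatR D) (ore D) (ore D) _
  (fun v w => tens (hatR D) (x * v) (w * y)).
Proof.
split=> [v v' w|v w w'|c v w hc].
- by rewrite mulrDr tensDl.
- by rewrite mulrDl tensDr.
by rewrite hatR_scaleAr // hatR_scaleAl tensZ.
Qed.

Lemma syz_actD x y : {morph (fun s => syz_act x s y) : s s' / s + s'}.
Proof.
move=> s s'; apply/ffunP => l; rewrite !ffunE.
exact: (tens_liftD (syz_act_balanced x y)).
Qed.

Lemma syz_act0 x y : syz_act x 0 y = 0.
Proof.
apply/ffunP => l; rewrite !ffunE; exact: (tens_lift0 (syz_act_balanced x y)).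
Qed.

Lemma syz_gr_actD x y : {morph (fun s => syz_gr_act x s y) : s s' / s + s'}.
Proof.
move=> s s'; apply/ffunP => l; rewrite !ffunE.
exact: (tens_liftD (syz_gr_act_balanced x y)).
Qed.

Lemma syz_gr_act0 x y : syz_gr_act x 0 y = 0 :> syz_mod D u.
Proof.
apply/ffunP => l; rewrite !ffunE; exact: (tens_lift0 (syz_gr_act_balanced x y)).
Qed.

Lemma syz_act_tens x y l v w :
  syz_act x (syz_tens l v w) y = syz_tens l (x * v) (w * y).
Proof.
apply/ffunP => j; rewrite !ffunE; case: eqP => _.
  exact: (tens_liftE (syz_act_balanced x y)).
exact: (tens_lift0 (syz_act_balanced x y)).
Qed.

Lemma syz_gr_act_tens x y l v w :
  syz_gr_act x (syz_tens l v w) y = syz_tens l (gr_mul x v) (gr_mul w y).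
Proof.
apply/ffunP => j; rewrite !ffunE; case: eqP => _.
  exact: (tens_liftE (syz_gr_act_balanced x y)).
exact: (tens_lift0 (syz_gr_act_balanced x y)).
Qed.

Lemma syz_gr_actDl s y x x' :
  syz_gr_act (x + x') s y = syz_gr_act x s y + syz_gr_act x' s y.
Proof.
elim/syz_ind: s => [|s s' E E'|l v w].
- by rewrite !syz_gr_act0 addr0.
- by rewrite !syz_gr_actD E E' addrACA.
by rewrite !syz_gr_act_tens gr_mulDl syz_tensDl.
Qed.

Lemma syz_gr_actDr s x y y' :
  syz_gr_act x s (y + y') = syz_gr_act x s y + syz_gr_act x s y'.
Proof.
elim/syz_ind: s => [|s s' E E'|l v w].
- by rewrite !syz_gr_act0 addr0.
- by rewrite !syz_gr_actD E E' addrACA.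
by rewrite !syz_gr_act_tens gr_mulDr syz_tensDr.
Qed.

Lemma gr_mul0l x : gr_mul 0 x = 0 :> ore D.
Proof. exact: (@mul0r (ore (graded D))). Qed.

Lemma gr_mul0r x : gr_mul x 0 = 0 :> ore D.
Proof. exact: (@mulr0 (ore (graded D))). Qed.

Lemma gr_mul1l x : gr_mul 1 x = x :> ore D.
Proof. exact: (@mul1r (ore (graded D))). Qed.

Lemma gr_mul1r x : gr_mul x 1 = x :> ore D.
Proof. exact: (@mulr1 (ore (graded D))). Qed.

Lemma syz_gr_act0l s y : syz_gr_act 0 s y = 0.
Proof.
elim/syz_ind: s => [|s s' E E'|l v w]; first exact: syz_gr_act0.
  by rewrite syz_gr_actD E E' addr0.
by rewrite syz_gr_act_tens gr_mul0l syz_tens0l.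
Qed.

Lemma syz_gr_act0r s x : syz_gr_act x s 0 = 0.
Proof.
elim/syz_ind: s => [|s s' E E'|l v w]; first exact: syz_gr_act0.
  by rewrite syz_gr_actD E E' addr0.
by rewrite syz_gr_act_tens gr_mul0r syz_tens0r.
Qed.

Lemma syz_gr_act11 s : syz_gr_act 1 s 1 = s.
Proof.
elim/syz_ind: s => [|s s' E E'|l v w]; first exact: syz_gr_act0.
  by rewrite syz_gr_actD E E'.
by rewrite syz_gr_act_tens gr_mul1l gr_mul1r.
Qed.

Section Eval.
Variables (m : nat) (g : 'I_u -> nonzero (ore_mod D m)).

Lemma syz_eval_act x s y : syz_eval g (syz_act x s y) = ore_act x (syz_eval g s) y.
Proof.
elim/syz_ind: s => [|s s' E E'|l v w].
- by rewrite syz_act0 !raddf0; apply/ffunP => i; rewrite !ffunE mulr0 mul0r.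
- rewrite syz_actD !raddfD /= E E'; apply/ffunP => i.
  by rewrite !ffunE mulrDr mulrDl.
by rewrite syz_act_tens !syz_eval_tens; apply/ffunP => i; rewrite !ffunE !mulrA.
Qed.

(** Identifies the bilateral module with the image of [syz_eval], so that membership becomes the
    choice of a syzygy. *)
Lemma bimodP f : bimod g f <-> exists s, syz_eval g s = f.
Proof.
split=> [[N [x [y [e [ge ->]]]]]|[s <-]].
  have /choice[l El] i : exists l, nz_val (g l) = e i by case: (ge i) => l; exists l.
  exists (\sum_(i < N) syz_tens (l i) (x i) (y i)); rewrite raddf_sum.
  by apply: eq_bigr => i _; rewrite /= syz_eval_tens El.
elim/syz_ind: s => [|s s'|l v w].
- have p0 (T : Type) : 'I_0 -> T by case.
  exists 0%N, (p0 _), (p0 _), (p0 _); split; first by case.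
  by rewrite raddf0 big_ord0.
- case=> [N1 [x1 [y1 [e1 [P1 E1]]]]] [N2 [x2 [y2 [e2 [P2 E2]]]]].
  pose mix T (a : 'I_N1 -> T) (b : 'I_N2 -> T) i :=
    match fintype.split i with inl j => a j | inr j => b j end.
  exists (N1 + N2)%N, (mix _ x1 x2), (mix _ y1 y2), (mix _ e1 e2).
  split=> [i|]; first by rewrite /mix; case: (fintype.split i).
  rewrite raddfD /= E1 E2 big_split_ord /mix.
  congr (_ + _); apply: eq_bigr => i _.
    by rewrite (unsplitK (inl _ i)).
  by rewrite (unsplitK (inr _ i)).
exists 1%N, (fun=> v), (fun=> w), (fun=> nz_val (g l)).
by split=> [_|]; [exists l|rewrite big_ord1 syz_eval_tens].
Qed.

Variables (prec : term_order n) (lt : mterm_order m prec).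

Lemma syz_act_lt (a b : R) p q d s : syz_supp lt g (fun t => lt t d) s ->
  syz_supp lt g (fun t => lt t (shift p q d)) (syz_act << a *g p >> s << b *g q >>).
Proof.
move: s; apply: syz_supp_ind => [|s s' Ps Ps'|e Pe].
- by rewrite syz_act0; exact: syz_supp0.
- by rewrite syz_actD; exact: syz_suppD.
rewrite syz_act_tens; apply: syz_supp_tens => p' q'.
case/(ore_mul_supp prec) => p1 [p2 [/mcoeffU_neq0[-> _] /mcoeffU_neq0[-> _] lp]].
case/(ore_mul_supp prec) => q1 [q2 [/mcoeffU_neq0[-> _] /mcoeffU_neq0[-> _] lq]].
apply: mle_mo_trans (shift_lt p q Pe); rewrite shiftA.
exact: shift_prle.
Qed.

Lemma syz_gr_act_supp (a b : R) p q d s : syz_supp lt g (fun t => t = d) s ->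
  syz_supp lt g (fun t => t = shift p q d) (syz_gr_act << a *g p >> s << b *g q >>).
Proof.
move: s; apply: syz_supp_ind => [|s s' Ps Ps'|e Pe].
- by rewrite syz_gr_act0; exact: syz_supp0.
- by rewrite syz_gr_actD; exact: syz_suppD.
rewrite syz_gr_act_tens; apply: syz_supp_tens => p' q'.
case/gr_mul_supp => p1 [p2 [/mcoeffU_neq0[-> _] /mcoeffU_neq0[-> _] ->]].
case/gr_mul_supp => q1 [q2 [/mcoeffU_neq0[-> _] /mcoeffU_neq0[-> _] ->]].
by rewrite -shiftA -Pe.
Qed.

Lemma syz_act_diff_lt (a b : R) p q d s : syz_supp lt g (fun t => t = d) s ->
  syz_supp lt g (fun t => lt t (shift p q d))
    (syz_act << a *g p >> s << b *g q >> - syz_gr_act << a *g p >> s << b *g q >>).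
Proof.
set x : ore D := << a *g p >>; set y : ore D := << b *g q >>.
move: s; apply: syz_supp_ind => [|s s' Ps Ps'|e Pe].
- by rewrite syz_act0 syz_gr_act0 subrr; exact: syz_supp0.
- by rewrite syz_actD syz_gr_actD opprDACA; exact: syz_suppD.
rewrite syz_act_tens syz_gr_act_tens.
set v : ore D := << _ *g _ >>; set w : ore D := << _ *g _ >>.
(* The left product is made graded first, then the right one. In the first error the left exponent
   drops and the right one does not grow; in the second the left exponent is exact and the right one
   drops. *)
rewrite -[x * v](subrK (gr_mul x v)) syz_tensDl -addrA.
rewrite -[in X in _ + (X - _)](subrK (gr_mul w y) (w * y)) syz_tensDr addrK.
rewrite -Pe; apply: syz_suppD; apply: syz_supp_tens => p' q'.
  case/(ore_mul_gr_supp prec) => p1 [p2 [/mcoeffU_neq0[-> _] /mcoeffU_neq0[-> _] lp]].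
  case/(ore_mul_supp prec) => q1 [q2 [/mcoeffU_neq0[-> _] /mcoeffU_neq0[-> _] lq]].
  rewrite shiftA; apply: mo_mle_trans (shift_prec_l lt _ _ lp) _.
  by apply: shift_prle => //; exact: prle_refl.
case/gr_mul_supp => p1 [p2 [/mcoeffU_neq0[-> _] /mcoeffU_neq0[-> _] ->]].
case/(ore_mul_gr_supp prec) => q1 [q2 [/mcoeffU_neq0[-> _] /mcoeffU_neq0[-> _] lq]].
by rewrite shiftA; exact: shift_prec_r.
Qed.

End Eval.
End Actions.

(** * Homogeneous parts, liftings, and the implications between the conditions *)

Section Lifting.
Set Implicit Arguments.
Unset Strict Implicit.
Import GRing.Theory.
Local Open Scope ring_scope.
Variables (R : nzRingType) (n : nat) (D : ore_data R n) (m u : nat).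
Variables (prec : term_order n) (lt : mterm_order m prec).
Variable g : 'I_u -> nonzero (ore_mod D m).
Implicit Types (s U : syz_mod D u) (d t : mterm n m) (f : nonzero (ore_mod D m)).
Implicit Types (sigma : nonzero (syz_mod D u)).

(** Unlike [leading_form], which is the case of [d] the degree of [s], this is defined for every [d]
    and for [s = 0], and is additive in [s]. *)
Definition hpart d s : syz_mod D u :=
  \sum_(k \in [set k | tdeg lt g k = d]) syz_comp k s.

Lemma syz_comp_hpart k d s :
  syz_comp k (hpart d s) = if tdeg lt g k == d then syz_comp k s else 0.
Proof.
rewrite /hpart; have [K HK] := syz_comp_supp s.
(* [K] contains all keys of nonzero components, so the sum over a set of keys becomes one over a
   duplicate-free list. *)
rewrite (@fsbigE _ _ _ _ _ [seq k <- undup K | tdeg lt g k == d]); first last.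
- move=> k' /= dk'; rewrite mem_filter mem_undup dk' eqxx /= => k'K.
  by apply: contrapT => /eqP/HK; exact/negP.
- by move=> k' /=; rewrite mem_filter => /andP[/eqP].
- by rewrite filter_uniq ?undup_uniq.
rewrite raddf_sum /=.
rewrite (eq_bigr (fun k' => if k' == k then syz_comp k s else 0)); last first.
  by move=> k' _; rewrite syz_compK eq_sym; case: eqP => // ->.
have [k0|k0] := eqVneq (syz_comp k s) 0.
  by rewrite k0 if_same big1 // => k' _; rewrite if_same.
rewrite big_filter_cond; case: eqP => dk; last first.
  rewrite big1 // => k' /andP[/eqP dk' _].
  by case: eqP => // E; rewrite E in dk'.
rewrite big_mkcond (bigD1_seq k) ?undup_uniq ?mem_undup ?HK //= dk eqxx.
rewrite mem_set //= eqxx big1 ?addr0 // => k' /negPf ->; exact: if_same.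
Qed.

Lemma leading_formE sigma : leading_form lt g sigma = hpart (syz_deg lt g sigma) sigma.
Proof. by []. Qed.

Lemma hpartD d s s' : hpart d (s + s') = hpart d s + hpart d s'.
Proof.
apply: syz_eqP => k; rewrite raddfD /= !syz_comp_hpart.
by case: eqP => _; rewrite ?raddfD ?addr0.
Qed.

Lemma hpart_supp d s : syz_supp lt g (fun t => t = d) (hpart d s).
Proof.
move=> k; rewrite syz_comp_hpart.
by have [->|_] := eqVneq (tdeg lt g k) d; rewrite ?eqxx.
Qed.

Lemma hpart_id d s : syz_supp lt g (fun t => t = d) s -> hpart d s = s.
Proof.
move=> sd; apply: syz_eqP => k; rewrite syz_comp_hpart.
have [->|/sd ->] := eqVneq (syz_comp k s) 0; [exact: if_same|by rewrite eqxx].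
Qed.

Lemma hpart_out d s : syz_supp lt g (fun t => t <> d) s -> hpart d s = 0.
Proof.
move=> sd; apply: syz_eqP => k; rewrite syz_comp_hpart raddf0.
by have [->|/sd/eqP/negPf ->] := eqVneq (syz_comp k s) 0; first exact: if_same.
Qed.

Lemma sub_hpart_lt d s : syz_supp lt g (fun t => mle lt t d) s ->
  syz_supp lt g (fun t => lt t d) (s - hpart d s).
Proof.
move=> sd k; rewrite raddfB /= syz_comp_hpart.
have [->|ne] := eqVneq (tdeg lt g k) d; first by rewrite subrr eqxx.
by rewrite subr0 => /sd; rewrite /mle (negPf ne).
Qed.

Lemma syz_deg_max sigma : syz_supp lt g (fun t => mle lt t (syz_deg lt g sigma)) sigma.
Proof. by rewrite /syz_deg; case: cid => t /= [_ H] k hk; apply: H; exists k. Qed.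

(** The degree is attained at a nonzero component. Depending on [P], this bounds the degree or
    computes it. *)
Lemma syz_deg_le sigma (P : mterm n m -> Prop) :
  syz_supp lt g P sigma -> P (syz_deg lt g sigma).
Proof. by rewrite /syz_deg; case: cid => t /= [[k hk ->] _] H; exact: H. Qed.

Lemma homogeneous_supp sigma : homogeneous lt g sigma ->
  syz_supp lt g (fun t => t = syz_deg lt g sigma) sigma.
Proof. by rewrite /homogeneous leading_formE => ->; exact: hpart_supp. Qed.

(** A lifting agrees with [sigma] up to lower degrees. In this form it can be added and multiplied
    without tracking leading forms or nonvanishing. *)
Lemma has_liftingP sigma : homogeneous lt g sigma ->
  has_lifting lt g sigma <-> exists2 U, syz_eval g U = 0 &
    syz_supp lt g (fun t => lt t (syz_deg lt g sigma)) (U - nz_val sigma).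
Proof.
move=> hs; set d := syz_deg lt g sigma; have sd := homogeneous_supp hs.
split=> [[U [U0 lU]]|[U U0 lU]].
  exists (nz_val U) => //; rewrite -lU leading_formE.
  suff <- : syz_deg lt g U = d by exact: sub_hpart_lt (@syz_deg_max U).
  have: syz_supp lt g (fun t => t = syz_deg lt g U) sigma.
    by rewrite -lU; exact: hpart_supp.
  by move/syz_deg_le.
have hU : hpart d U = sigma.
  rewrite -[U](subrK (nz_val sigma)) hpartD (hpart_id sd) hpart_out ?add0r //.
  by apply: sub_syz_supp lU => t td E; rewrite E mo_irr in td.
have Une : U != 0.
  apply/eqP => E; have := nz_neq0 sigma.
  by rewrite -hU E hpart_out ?eqxx //; exact: syz_supp0.
pose V := Nonzero U Une; have Vd : syz_supp lt g (fun t => mle lt t d) (nz_val V).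
  rewrite /= -[U](subrK (nz_val sigma)).
  apply: syz_suppD; first by apply: sub_syz_supp lU => t; rewrite /mle orbC => ->.
  by apply: sub_syz_supp sd => t ->; exact: mle_refl.
(* A nonzero component of [sigma] is also one of [U], so the degree of [U] cannot be smaller than
   [d]. *)
have dV : mle lt d (syz_deg lt g V).
  have [k hk] := syz_comp_neq0 (nz_neq0 sigma).
  rewrite /d -(sd k hk); apply: (@syz_deg_max V) => /=.
  by move: hk; rewrite -hU syz_comp_hpart; case: ifP; rewrite ?eqxx.
exists V; split=> //.
by rewrite leading_formE (mle_anti (syz_deg_le Vd) dV).
Qed.

Lemma syz_eval_lt d s : gr_syz_eval lt g s = 0 ->
  syz_supp lt g (fun t => mle lt t d) s ->
  mod_supp (fun t => lt t d) (syz_eval g s).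
Proof. by move=> s0 /syz_eval_diff_lt; rewrite s0 subr0. Qed.

Lemma weak_groebner_reprP f : weak_groebner_repr lt g f <->
  exists2 s, syz_supp lt g (fun t => mle lt t (lterm lt f)) s & syz_eval g s = f.
Proof. exact: representedP (syz_eval_tens g) _ _. Qed.

Lemma lmon_representedP f :
  represented lt g (@gr_act R n D m) (fun l => lmon lt (g l)) (fun t => t = lterm lt f)
    (lmon lt f) <->
  exists2 s, syz_supp lt g (fun t => t = lterm lt f) s & gr_syz_eval lt g s = lmon lt f.
Proof. exact: representedP (gr_syz_eval_tens lt g) _ _. Qed.

Lemma quasi_groebner_reprP sigma : quasi_groebner_repr lt g sigma <->
  exists2 s, syz_supp lt g (fun t => lt t (syz_deg lt g sigma)) s &
    syz_eval g s = syz_eval g sigma.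
Proof. exact: representedP (syz_eval_tens g) _ _. Qed.

Lemma lterm_in f (P : mterm n m -> Prop) : mod_supp P f -> P (lterm lt f).
Proof. by apply; exact: lterm_neq0. Qed.

Lemma weak_groebner_basis_repr f :
  weak_groebner_basis lt g -> bimod g f -> weak_groebner_repr lt g f.
Proof.
move=> GB Mf; apply/weak_groebner_reprP; move: Mf.
have [_ _ _ wf] := mo_wo lt; have [d] : {d | lterm lt f = d} by exists (lterm lt f).
elim/(well_founded_ind wf): d f => d IH f fd Mf.
have /lmon_representedP[s sd sE] := GB f Mf; rewrite fd in sd *.
have sle : syz_supp lt g (fun t => mle lt t d) s.
  by apply: sub_syz_supp sd => t ->; exact: mle_refl.
have hlt : mod_supp (fun t => lt t d) (nz_val f - syz_eval g s).
  (* Both brackets lie below [d]: the tail of [f], and the error between the two evaluations of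
     [s]. *)
  have -> : nz_val f - syz_eval g s = (nz_val f - lmon lt f) -
      (syz_eval g s - gr_syz_eval lt g s) by rewrite sE opprB addrA subrK.
  apply: mod_suppB; last exact: syz_eval_diff_lt.
  by rewrite -fd; exact: lmon_lt.
have [h0|hne] := eqVneq (nz_val f - syz_eval g s) 0.
  by exists s => //; apply/esym/subr0_eq.
pose h := Nonzero _ hne; have hd : lt (lterm lt h) d := lterm_in (f := h) hlt.
have [|s' s'h s'E] := IH _ hd h erefl.
  have /bimodP[s0 s0E] := Mf; apply/bimodP; exists (s0 - s).
  by rewrite raddfB /= s0E.
exists (s + s'); last by rewrite raddfD /= s'E addrC subrK.
apply: syz_suppD => //; apply: sub_syz_supp s'h => t th.
by rewrite /mle (mle_mo_trans th hd) orbT.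
Qed.

Lemma groebner_repr_quasi sigma :
  (forall f, bimod g f -> weak_groebner_repr lt g f) ->
  gr_syz_eval lt g sigma = 0 -> quasi_groebner_repr lt g sigma.
Proof.
move=> GR s0; apply/quasi_groebner_reprP.
(* A vanishing S-polynomial has no leading term, but the empty sum represents it. *)
have [E0|ne] := eqVneq (syz_eval g sigma) 0.
  by exists 0; [exact: syz_supp0|rewrite raddf0].
pose f := Nonzero _ ne.
have [|s sf sE] := (weak_groebner_reprP f).1 (GR f _).
  by apply/bimodP; exists (nz_val sigma).
exists s => //; apply: sub_syz_supp sf => t tf; apply: mle_mo_trans tf _.
exact: (lterm_in (f := f) (syz_eval_lt s0 (@syz_deg_max sigma))).
Qed.

Lemma quasi_has_lifting sigma : homogeneous lt g sigma ->
  quasi_groebner_repr lt g sigma -> has_lifting lt g sigma.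
Proof.
move=> hs /quasi_groebner_reprP[s sd sE]; apply/has_liftingP => //.
exists (nz_val sigma - s); first by rewrite raddfB /= sE subrr.
by rewrite addrAC subrr sub0r; exact: syz_suppN.
Qed.

(** Stated for the part of degree [d] of any element of the span, so that the claim is additive and
    reduces to one generator multiplied by monomials on both sides. *)
Lemma bispan_lifting (GM : set (nonzero (syz_mod D u))) s d :
  (forall sigma, GM sigma -> homogeneous lt g sigma) ->
  (forall sigma, GM sigma -> has_lifting lt g sigma) ->
  bispan (@syz_gr_act R n D u) [set nz_val sigma | sigma in GM] s ->
  exists2 U, syz_eval g U = 0 & syz_supp lt g (fun t => lt t d) (U - hpart d s).
Proof.
move=> hom lift [N [x [y [e [eGM ->]]]]].
pose Q s := exists2 U, syz_eval g U = 0 &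
  syz_supp lt g (fun t => lt t d) (U - hpart d s).
have Q0 : Q 0.
  by exists 0; rewrite ?raddf0 // hpart_out ?subrr; exact: syz_supp0.
have QD s1 s2 : Q s1 -> Q s2 -> Q (s1 + s2).
  case=> [U1 U10 lt1] [U2 U20 lt2]; exists (U1 + U2).
    by rewrite raddfD /= U10 U20 addr0.
  rewrite hpartD opprDACA; exact: syz_suppD.
apply: (big_ind Q); [exact: Q0|exact: QD|move=> i _].
have [sigma GMs <-] := eGM i.
elim/ore_ind: (x i) => [|x1 x2 Q1 Q2|a p]; first by rewrite syz_gr_act0l.
  by rewrite syz_gr_actDl; exact: QD.
elim/ore_ind: (y i) => [|y1 y2 Q1 Q2|b q]; first by rewrite syz_gr_act0r.
  by rewrite syz_gr_actDr; exact: QD.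
have hs := hom _ GMs; have sd := homogeneous_supp hs.
have [U U0 lU] := (has_liftingP hs).1 (lift _ GMs).
have gsd := syz_gr_act_supp (a := a) (b := b) (p := p) (q := q) sd.
(* Such a multiple is homogeneous; in a degree other than [d] it contributes nothing, and [U = 0]
   serves. *)
have [E|ne] := eqVneq (shift p q (syz_deg lt g sigma)) d; last first.
  exists 0; first exact: raddf0.
  rewrite hpart_out ?subrr; first exact: syz_supp0.
  by apply: sub_syz_supp gsd => t -> /eqP; exact/negP.
(* The difference splits into the action on [U - sigma], which stays lower, and the error between
   the two actions on [sigma]. *)
exists (syz_act << a *g p >> U << b *g q >>).
  by rewrite syz_eval_act U0; apply/ffunP => j; rewrite !ffunE mulr0 mul0r.
rewrite -E (hpart_id gsd) -{1}[U](subrK (nz_val sigma)) syz_actD -addrA.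
apply: syz_suppD; [exact: syz_act_lt|exact: syz_act_diff_lt].
Qed.

Lemma lifting_groebner :
  (forall sigma, homogeneous lt g sigma -> gr_syz_eval lt g sigma = 0 ->
     has_lifting lt g sigma) -> weak_groebner_basis lt g.
Proof.
move=> lift f /bimodP[s sE]; apply/lmon_representedP.
have sne s' : syz_eval g s' = f -> s' != 0.
  by move=> E; apply/eqP => s0; have := nz_neq0 f; rewrite -E s0 raddf0 eqxx.
have [_ _ _ wf] := mo_wo lt.
have [d sd] : exists d, syz_supp lt g (fun t => mle lt t d) s.
  by exists (syz_deg lt g (Nonzero s (sne s sE))); exact: (@syz_deg_max (Nonzero _ _)).
(* The induction is on an upper bound [d] for the degrees in [s], while [f] stays fixed. *)
elim/(well_founded_ind wf): d s sE sd => d IH s sE sd.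
have fd : mod_supp (fun t => mle lt t d) f by rewrite -sE; exact: syz_eval_le.
have sdiff := syz_eval_diff_lt sd.
have ldiff := sub_hpart_lt sd.
(* Up to terms below [d], [f] is the graded evaluation of the part of [s] of degree [d]. *)
have hdiff : mod_supp (fun t => lt t d) (nz_val f - gr_syz_eval lt g (hpart d s)).
  have -> : nz_val f - gr_syz_eval lt g (hpart d s) =
      (syz_eval g s - gr_syz_eval lt g s) + gr_syz_eval lt g (s - hpart d s).
    by rewrite sE raddfB /= addrA subrK.
  by apply: mod_suppD => //; exact: gr_syz_eval_supp.
have hsupp := gr_syz_eval_supp (@hpart_supp d s).
have supp0 (h : ore_mod D m) : mod_supp (fun t => lt t d) h ->
    mod_supp (fun t => t = d) h -> h = 0.
  move=> h1 h2; apply/ffunP => i; apply/malgP => t; rewrite ffunE mcoeff0.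
  apply: contrapT => /eqP ht; have := h1 (t, i) ht.
  by rewrite (h2 (t, i) ht) mo_irr.
have := lterm_in fd; rewrite /mle => /orP[/eqP fE|fltd].
  exists (hpart d s); first by rewrite fE; exact: hpart_supp.
  apply/esym/subr0_eq/supp0; last first.
    by apply: mod_suppB => //; rewrite -fE; exact: lmon_supp.
  have -> : lmon lt f - gr_syz_eval lt g (hpart d s) =
      (nz_val f - gr_syz_eval lt g (hpart d s)) - (nz_val f - lmon lt f).
    by rewrite opprB [RHS]addrC addrA subrK.
  by apply: mod_suppB; [exact: hdiff|rewrite -fE; exact: lmon_lt].
(* From here on the bound exceeds the leading term of [f], and a preimage of [f] with lower degrees
   is sought. *)
suff [s' s'E s'd] : exists2 s', syz_eval g s' = f & syz_supp lt g (fun t => lt t d) s'.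
  pose s1 := Nonzero s' (sne _ s'E).
  have s1d : lt (syz_deg lt g s1) d := syz_deg_le (sigma := s1) s'd.
  exact: (IH _ s1d s' s'E (@syz_deg_max s1)).
(* As [d] is only a bound, [s] may have no component of that degree, and then it is already
   lower. *)
have [h0|hne] := eqVneq (hpart d s) 0.
  by exists s => //; rewrite -[s]subr0 -h0.
pose h := Nonzero _ hne.
have hd : syz_deg lt g h = d := syz_deg_le (sigma := h) (@hpart_supp d s).
have hhom : homogeneous lt g h.
  by rewrite /homogeneous leading_formE hd hpart_id //; exact: hpart_supp.
have hker : gr_syz_eval lt g h = 0.
  (* All terms of [f] are below [d], so by [hdiff] those of the graded evaluation of [h] are too;
     but they also have degree [d], hence there are none. *)
  apply: supp0 => //; rewrite -[X in mod_supp _ X](subKr (nz_val f)).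
  apply: mod_suppB => //; apply: sub_mod_supp (@lterm_max _ _ _ _ _ lt f) => t tf.
  exact: mle_mo_trans tf fltd.
have [U U0] := (has_liftingP hhom).1 (lift h hhom hker); rewrite hd => lU.
exists (s - U); first by rewrite raddfB /= U0 subr0.
have -> : s - U = (s - hpart d s) - (U - hpart d s) by rewrite opprB addrA subrK.
exact: syz_suppB ldiff lU.
Qed.

End Lifting.

Theorem theorem37 (R : nzRingType) (R_domain : GRing.integral_domain_axiom R)
  (n : nat) (D : ore_data R n) (m u : nat)
  (prec : term_order n) (lt : mterm_order m prec)
  (g : 'I_u -> nonzero (ore_mod D m))
  (GM : set (nonzero (syz_mod D u))) (GM_gens : gebauer_moeller lt g GM) :
  [<-> weak_groebner_basis lt g;
       forall f : nonzero (ore_mod D m), bimod g f <-> weak_groebner_repr lt g f;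
       forall s : nonzero (syz_mod D u), GM s -> quasi_groebner_repr lt g s;
       forall s : nonzero (syz_mod D u), GM s -> has_lifting lt g s;
       forall s : nonzero (syz_mod D u),
         homogeneous lt g s -> gr_syz_eval lt g s = 0%R -> has_lifting lt g s].
Proof.
have [hom span] := GM_gens.
have kerGM s : GM s -> gr_syz_eval lt g s = 0%R.
  move=> GMs; suff : bispan (@syz_gr_act R n D u) [set nz_val s | s in GM]%classic s.
    by rewrite span.
  (* Each generator lies in its own span, as the multiple of itself by [1] on both sides. *)
  exists 1%N, (fun=> 1%R), (fun=> 1%R), (fun=> nz_val s).
  by split=> [_|]; [exists s|rewrite big_ord1 syz_gr_act11].
tfae.
- move=> GB f; split; first exact: weak_groebner_basis_repr.
  (* A representation is a value of [syz_eval], which puts [f] into the bilateral module. *)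
  by move=> /weak_groebner_reprP[s _ sE]; apply/bimodP; exists s.
- by move=> GR s GMs; apply: groebner_repr_quasi (kerGM s GMs) => f /GR.
- by move=> QR s GMs; apply: quasi_has_lifting (QR s GMs); exact: hom.
- move=> lift s hs s0; apply/has_liftingP => //.
  have : bispan (@syz_gr_act R n D u) [set nz_val s | s in GM]%classic s.
    by rewrite span.
  case/(bispan_lifting (syz_deg lt g s) hom lift) => U U0 lU; exists U => //.
  (* A homogeneous [s] is its own part in degree [syz_deg lt g s]. *)
  by move: lU; rewrite hpart_id //; exact: homogeneous_supp.
- exact: lifting_groebner.
Qed.
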